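(* Let $n\in\mathbb{N}$ and let $d_0,\dots,d_n\in[n,\infty]$ be such that $d_n\leq\dots\leq d_0$. Then there exists a compact metric space $K$ such that $\dim_t K=n$ and $\dim_{t^kH}K=d_k$ for all $k\in\{0,\dots,n\}$.
   Context: $\mathbb{N}=\{0,1,2,\dots\}$. $\dim_H$ is Hausdorff dimension, with $\dim_H\emptyset=-1$. $\dim_t$ is the small inductive topological dimension: $\dim_t\emptyset=-1$ and, for non-empty $X$, $\dim_t X=\inf\{d: X \text{ has a basis } \mathcal{U} \text{ such that } \dim_t\partial U\leq d-1 \text{ for every } U\in\mathcal{U}\}$. The $n$th inductive topological Hausdorff dimension: $\dim_{t^nH}\emptyset=-1$ for all $n\in\mathbb{N}$, and for non-empty $X$, $\dim_{t^0H}X=\dim_H X$ and, for $n\geq 1$, $\dim_{t^nH}X=\inf\{d: X\text{ has a basis }\mathcal{U}\text{ such that }\dim_{t^{n-1}H}\partial U\leq d-1\text{ for every }U\in\mathcal{U}\}$. All these dimensions may be $\infty$ (so $d=\infty$ is allowed in the infima), with $\infty-1=\infty$. *)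

(* Defs.v *)
From HB Require Import structures.
From mathcomp Require Import all_boot all_order all_algebra.
From mathcomp Require Import all_classical all_reals all_analysis.

Set Implicit Arguments.
Unset Strict Implicit.
Unset Printing Implicit Defensive.

Import Order.TTheory GRing.Theory Num.Theory.
Import numFieldNormedType.Exports.

Local Open Scope classical_set_scope.
Local Open Scope ring_scope.
Local Open Scope ereal_scope.

(* The induced metric on a subset [A] of a metric space, over the
   subspace topology that the library already puts on the type [A]. *)
Section subset_metric.
Context {R : realType} {X : metricType R} (A : set X).

Let sub_dist (x y : A) : R := mdist (set_val x) (set_val y).

Let sub_dist_ge0 x y : (0 <= sub_dist x y)%R.
Proof. exact: mdist_ge0. Qed.

Let sub_dist_positivity x y : sub_dist x y = 0%R -> x = y.
Proof. by move/mdist_positivity; exact: val_inj. Qed.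

Let sub_ballE (x : A) (d : R) : ball x d = [set y | (sub_dist x y < d)%R].
Proof. exact: (congr1 (preimage set_val) (ballEmdist (set_val x) d)). Qed.

HB.instance Definition _ := PseudoMetric_isMetric.Build R (A : Type)
  sub_dist_ge0 sub_dist_positivity sub_ballE.

End subset_metric.

Section hausdorff_dimension.
Context {R : realType} {X : metricType R}.

(* [diam set0 = -oo]; the value on [set0] is only used in upper bounds. *)
Definition diam (A : set X) : \bar R :=
  ereal_sup [set (mdist p.1 p.2)%:E | p in A `*` A].

(* The empty set contributes 0 for every [s], including [s = 0], so that a
   sequence of sets may stand for a finite cover. *)
Definition diam_pow (s : R) (A : set X) : \bar R :=
  if A == set0 then 0 else diam A `^ s.

Definition hausdorff_content (s delta : R) (A : set X) : \bar R :=
  ereal_inf [set \sum_(0 <= i <oo) diam_pow s (U i) |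
    U in [set U : (set X)^nat |
           A `<=` \bigcup_i U i /\ forall i, diam (U i) <= delta%:E]].

(* The contents increase as [delta] decreases to 0, hence the supremum. *)
Definition hausdorff_measure (s : R) (A : set X) : \bar R :=
  ereal_sup [set hausdorff_content s delta A | delta in [set e | (0 < e)%R]].

End hausdorff_dimension.

Definition dim_H {R : realType} (X : metricType R) : \bar R :=
  if [set: X] == set0 then -1 else
  ereal_inf [set s%:E | s in
    [set s : R | (0 <= s)%R /\ hausdorff_measure s [set: X] < +oo]].

Definition boundary {X : topologicalType} (A : set X) : set X :=
  closure A `\` A°.

(* [dim_t_lt n X] says that the small inductive dimension of [X] is at most
   [n - 1]; the shift makes the recursion start at dimension -1. *)
Fixpoint dim_t_lt (n : nat) (X : topologicalType) : Prop :=
  if n is m.+1 then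
    exists2 B : set (set X), basis B &
      forall U, B U -> dim_t_lt m (boundary U)
  else [set: X] = set0.

(* The infimum of the empty set is [+oo]. See [dim_t0] and [dim_tE] for the
   recursive equations that characterize [dim_t]. *)
Definition dim_t (R : realType) (X : topologicalType) : \bar R :=
  ereal_inf [set (n%:R - 1)%R%:E | n in [set n | dim_t_lt n X]].

Fixpoint dim_tH {R : realType} (n : nat) (X : metricType R) : \bar R :=
  if [set: X] == set0 then -1 else
  if n is m.+1 then
    ereal_inf [set d | exists2 B : set (set X), basis B &
      forall U, B U -> dim_tH m (boundary U) <= d - 1]
  else dim_H X.

Section dim_t_theory.
Context {R : realType}.
Implicit Type X : topologicalType.

Lemma dim_t_ltS n X : dim_t_lt n X -> dim_t_lt n.+1 X.
Proof.
elim: n X => [|n ih] X /=.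
  move=> X0; exists set0; last by [].
  by split=> // x; have : [set: X] x by []; rewrite X0.
by move=> [B bB BX]; exists B => // U /BX /ih.
Qed.

Lemma dim_t_ltW m n X : (m <= n)%N -> dim_t_lt m X -> dim_t_lt n X.
Proof.
move=> /subnK <-; elim: (n - m)%N => [//|k ih] mX.
by rewrite addSn; exact/dim_t_ltS/ih.
Qed.

Lemma dim_t_ge X : -1%:E <= dim_t R X.
Proof.
by apply: le_ereal_inf_tmp => _ [n _ <-]; rewrite lee_fin lerBrDl subrr ler0n.
Qed.

Lemma dim_t_le n X : dim_t_lt n X -> dim_t R X <= (n%:R - 1)%R%:E.
Proof. by move=> nX; apply: ereal_inf_lbound; exists n. Qed.

Lemma dim_t_ltP n X : dim_t R X < n%:R%:E -> dim_t_lt n X.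
Proof.
move=> Xn; apply: contrapT => nX; move: Xn; apply/negP; rewrite -leNgt.
apply: le_ereal_inf_tmp => _ [m mX <-]; rewrite lee_fin lerBrDl addrC.
have nm : (n < m)%N by rewrite ltnNge; apply/negP => /dim_t_ltW /(_ mX).
by rewrite natr1 ler_nat.
Qed.

Lemma dim_t0 X : [set: X] = set0 -> dim_t R X = -1.
Proof.
move=> X0; apply/eqP; rewrite eq_le dim_t_ge andbT.
by have := @dim_t_le 0 X X0; rewrite sub0r.
Qed.

Lemma dim_tE X : [set: X] !=set0 ->
  dim_t R X = ereal_inf [set d | exists2 B : set (set X), basis B &
    forall U, B U -> dim_t R (boundary U) <= d - 1].
Proof.
move=> [x _]; apply/eqP; rewrite eq_le; apply/andP; split; last first.
  apply: le_ereal_inf_tmp => _ [[|n] nX <-].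
    by have : [set: X] x by []; rewrite nX.
  case: nX => B bB BX; apply: ereal_inf_lbound; exists B => // U /BX.
  by move=> /dim_t_le; rewrite -EFinB -natr1 addrK.
apply: le_ereal_inf_tmp => d [B bB BX].
have [U BU] : exists U, B U.
  by have [_ /(_ x setT filterT)[U [BU _] _]] := bB; exists U.
have := le_trans (dim_t_ge _) (BX _ BU).
case: d BX => [r| |] BX; [|by move=> _; exact: leey|by []].
rewrite -EFinB lee_fin lerBrDl subrr => r0.
have /andP[tr rt] := Num.Theory.truncn_itv r0.
apply: (@le_trans _ _ (Num.truncn r)%:R%:E); last by rewrite lee_fin.
suff /dim_t_le : dim_t_lt (Num.truncn r).+1 X by rewrite -natr1 addrK.
exists B => // V /BX; rewrite -EFinB => Vr; apply: dim_t_ltP.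
by apply: (le_lt_trans Vr); rewrite lte_fin ltrBlDr natr1.
Qed.

End dim_t_theory.

(* Main.v *)
(* K is the union over k <= n of C_k * [0,1]^k, where C_k is the space of binary words,
   metrized by a gauge for which it has Hausdorff dimension d_k - k.

   Upper bounds: boxes whose endpoints avoid a finite set Q form a basis, and
   a boundary point of such a box has one more coordinate in a finite set. After l steps
   at most k - l coordinates are free in the k-th piece, which box counting then bounds
   by the maximum of the d_k - l over k >= l, that is d_l - l.

   Lower bounds: let all fibres over a set S with positive t-dimensional Hausdorff measure
   have covering dimension at least j. For each basis, passing to a countable subfamily,
   some member U has a boundary whose fibres have covering dimension at least j - 1 over
   a part of S that still has positive measure; so j boundaries leave a set projecting
   onto a set of positive measure. Covering dimension replaces the small inductive one
   on the fibres because it is elementary that the cube [0,1]^k has covering dimension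
   at least k (Sperner's lemma) and because covering dimension is at most m as soon as
   there is a basis with boundaries of covering dimension at most m - 1. *)
Require Import Defs.
From HB Require Import structures.
From mathcomp Require Import all_boot all_order all_algebra.
From mathcomp Require Import fingroup perm.
From mathcomp Require Import all_classical all_reals all_analysis.
From mathcomp Require Import zify lra ring.

Set Implicit Arguments.
Unset Strict Implicit.
Unset Printing Implicit Defensive.

Import Order.TTheory GRing.Theory Num.Theory.
Import numFieldNormedType.Exports.

Local Open Scope classical_set_scope.
Local Open Scope ring_scope.
Local Open Scope ereal_scope.

(** * A Sperner lemma for the cube *)

Local Open Scope ring_scope.

Section sperner.
Context (m N : nat) (lab : ('I_m -> nat) -> nat).
Context (N0 : (0 < N)%N).
Context (lab_le : forall x, (lab x <= m)%N).
Context (lab0 : forall x (i : 'I_m), x i = 0%N -> lab x != i.+1).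
Context (labN : forall x (i : 'I_m), x i = N -> lab x != 0%N).

(** Modulo 2 this is 1 exactly when the labels of [P 0], ..., [P n] are 0, ..., [n] in some order:
    the matrix is then a permutation matrix, and otherwise it has a zero row. *)
Definition full_det n (P : nat -> 'I_m -> nat) : 'F_2 :=
  \det (\matrix_(i < n.+1, j < n.+1) ((lab (P j) == i)%:R : 'F_2)).

Lemma F2_opp (x : 'F_2) : - x = x.
Proof. by apply/eqP; case: x => -[|[|x]] xlt. Qed.

Lemma F2_double (x : 'F_2) : x + x = 0.
Proof. by rewrite -[X in X + _]F2_opp addNr. Qed.

Lemma F2_sign n : (-1) ^+ n = 1 :> 'F_2.
Proof. by rewrite F2_opp expr1n. Qed.

(* Adding all the other rows to the last one turns the latter into the
   constant row 1, along which the determinant is expanded. *)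
Lemma full_det_facets n (P : nat -> 'I_m -> nat) :
  (forall k, (k <= n.+1)%N -> (lab (P k) <= n.+1)%N) ->
  full_det n.+1 P = \sum_(j < n.+2) full_det n (P \o bump j).
Proof.
move=> labP; rewrite /full_det; set A := \matrix_(i, j) _.
pose L : 'M['F_2]_(n.+2) := \matrix_(i, j) ((i == j) || (i == ord_max))%:R.
have Ltrig : is_trig_mx L.
  apply/is_trig_mxP => i j ij; rewrite mxE; case: eqVneq => [ji|_] /=.
    by rewrite ji ltnn in ij.
  case: eqVneq => [im|//]; move: (ltn_ord j) ij; rewrite im /=; lia.
have -> : \det A = \det (L *m A).
  rewrite det_mulmx det_trig // big1 ?mul1r // => i _.
  by rewrite mxE eqxx.
rewrite (expand_det_row _ ord_max); apply: eq_bigr => j _.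
have -> : (L *m A) ord_max j = 1.
  rewrite mxE (bigD1 (Ordinal (labP j (ltn_ord j) : (_ < n.+2)%N))) //=.
  rewrite !mxE eqxx orbT mul1r /= eqxx big1 ?addr0 // => i ine.
  rewrite !mxE; case: (eqVneq (lab _) _) => [e|_]; last by rewrite mulr0.
  by move: ine; rewrite -val_eqE /= e eqxx.
rewrite mul1r /cofactor F2_sign mul1r; congr (\det _).
apply/matrixP => i k; rewrite !mxE (bigD1 (lift ord_max i)) //=.
rewrite !mxE eqxx mul1r big1 ?addr0 //= => [|l li].
  by rewrite /bump [in (_ == _)](leqNgt n.+1) ltn_ord add0n.
rewrite !mxE [lift _ _ == l]eq_sym (negPf li) [_ == ord_max]eq_sym.
by rewrite (negPf (neq_lift _ _)) mul0r.
Qed.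

Lemma full_det_surj n P : full_det n P != 0 ->
  forall a : 'I_n.+1, exists k : 'I_n.+1, lab (P k) = a.
Proof.
move=> D0 a; have [/existsP[k /eqP e]|/existsPn N1] :=
  boolP [exists k : 'I_n.+1, lab (P k) == a]; first by exists k.
case/eqP: D0; rewrite /full_det (expand_det_row _ a) big1 // => j _.
by rewrite mxE (negPf (N1 j)) mul0r.
Qed.

Lemma eq_full_det n P Q :
  (forall k, (k <= n)%N -> P k =1 Q k) -> full_det n P = full_det n Q.
Proof.
move=> PQ; congr (\det _); apply/matrixP => i j; rewrite !mxE.
by rewrite (_ : P j = Q j) //; apply/funext/PQ; rewrite -ltnS.
Qed.

(** Simplices of Kuhn's triangulation of the grid: a corner and the order in which the coordinates
    are raised by one. *)
Let cell := ({ffun 'I_m -> 'I_N.+1} * 'S_m)%type.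

(* [p.2 i] is the step at which the [i]-th coordinate is incremented in the chain
   of vertices starting from the corner [p.1]. *)
Definition vert (p : cell) (k : nat) (i : 'I_m) : nat := (p.1 i + (p.2 i < k))%N.

(** These are the [n]-dimensional simplices of the face where the coordinates from [n] on vanish;
    only the first [n.+1] vertices of the chain count. Fixing the rest of the permutation makes the
    encoding unique. *)
Definition cells n : pred cell := fun p =>
  [forall i, (p.1 i < N)%N && ((n <= i)%N ==> (p.1 i == 0 :> nat) && (p.2 i == i))].

Lemma cellsP n (p : cell) : reflect
  (forall i, (p.1 i < N)%N /\ ((n <= i)%N -> p.1 i = 0%N :> nat /\ p.2 i = i))
  (cells n p).
Proof.
apply: (iffP forallP) => H i.
  have /andP[? /implyP H2] := H i; split=> // /H2 /andP[/eqP ? /eqP ?]; by [].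
have [-> H2] := H i; apply/implyP => /H2[-> ->]; by rewrite !eqxx.
Qed.

(** On that face the coordinates from [n] on are 0, so [lab0] forbids the labels above [n]. *)
Lemma lab_vert n (p : cell) k : cells n p -> (k <= n)%N -> (lab (vert p k) <= n)%N.
Proof.
move=> /cellsP cp kn; rewrite leqNgt; apply/negP => nl.
have lt : ((lab (vert p k)).-1 < m)%N by have := lab_le (vert p k); lia.
have [_ /(_ _)[|v0 s0]] := cp (Ordinal lt); first by rewrite /=; lia.
have vl : vert p k (Ordinal lt) = 0%N by rewrite /vert v0 s0 /=; lia.
by move: (lab0 vl) nl => /=; lia.
Qed.

(* Exchanging two consecutive steps of the chain changes the [j]-th vertex only. *)
Lemma sum_middle n j : (n < m)%N -> (0 < j <= n)%N ->
  \sum_(p | cells n.+1 p) full_det n (vert p \o bump j) = 0.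
Proof.
move=> nm /andP[j0 jn]; pose F (p : cell) := full_det n (vert p \o bump j).
change (\sum_(p | cells n.+1 p) F p = 0).
have jm : (j < m)%N by lia.
have jm1 : (j.-1 < m)%N by lia.
pose t : 'S_m := tperm (Ordinal jm1) (Ordinal jm).
have tE (x : 'I_m) k : k != j -> (t x < k)%N = (x < k)%N.
  move=> kj; rewrite /t; case: tpermP => [->|->|//] /=; lia.
pose f (p : cell) : cell := (p.1, (p.2 * t)%g).
have f_inj : injective f by move=> [v s] [v' s'] [-> /mulIg ->].
have fcells p : cells n.+1 (f p) = cells n.+1 p.
  rewrite /cells; apply: eq_forallb => i /=; rewrite permM.
  case: (leqP n.+1 i) => ni //=; congr (_ && (_ && _)).
  have ti : t i = i by rewrite /t tpermD // -val_eqE /=; lia.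
  by rewrite -{2}ti (inj_eq perm_inj).
have Ff p : F (f p) = F p.
  apply: eq_full_det => k kn i; rewrite /vert /= permM tE //.
  by rewrite /bump; lia.
(* Composing with a transposition flips the parity, so even and odd cells give equal sums, which
   cancel in characteristic 2. *)
rewrite (bigID (fun p : cell => odd_perm p.2)) /= [X in _ + X](reindex_inj f_inj) /=.
rewrite [X in _ + X](eq_big (fun p => cells n.+1 p && odd_perm p.2) F) ?F2_double //.
move=> p; rewrite fcells; congr (_ && _); rewrite odd_permM odd_tperm.
by rewrite -val_eqE /= (_ : (j.-1 != j)); [rewrite addbT negbK|lia].
Qed.

(** The cycle sending 0 to [n] and lowering 1, ..., [n] by one: it makes the first step of a chain
    the last. *)
Definition rotf n (x : 'I_m) : 'I_m :=
  insubd x (if (n < x)%N then nat_of_ord x else if x == 0%N :> nat then n else x.-1).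

Lemma rotfE n (x : 'I_m) : (n < m)%N -> rotf n x =
  (if (n < x)%N then nat_of_ord x else if x == 0%N :> nat then n else x.-1) :> nat.
Proof.
move=> nm; rewrite val_insubd ifT //; have := ltn_ord x.
by do 2?case: ifP; lia.
Qed.

Lemma rotf_inj n : (n < m)%N -> injective (rotf n).
Proof.
move=> nm x y /(congr1 (@nat_of_ord m)); rewrite !rotfE // => xy.
by apply: ord_inj; move: xy; do 4?case: ifP; lia.
Qed.

(* Rotating the chain turns a facet without its first vertex into one without its
   last vertex; what remains unmatched lies on the boundary of the cube, where
   only the face on which the [n]-th coordinate vanishes contributes. *)
Lemma sum_ends n : (n < m)%N ->
  \sum_(p | cells n.+1 p) full_det n (vert p \o bump 0) +
  \sum_(p | cells n.+1 p) full_det n (vert p \o bump n.+1) =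
  \sum_(p | cells n p) full_det n (vert p).
Proof.
move=> nm; pose r : 'S_m := perm (rotf_inj nm).
have rE x : r x = (if (n < x)%N then nat_of_ord x
    else if x == 0%N :> nat then n else x.-1) :> nat by rewrite permE rotfE.
(* The corner is raised along the first step; adding modulo [N.+1] keeps [rot] injective even where
   the corner leaves the grid. *)
pose one (b : bool) : 'I_N.+1 := inZp b.
pose rot (p : cell) : cell := ([ffun i => (p.1 i + one (p.2 i == 0 :> nat))%R], (p.2 * r)%g).
have rot_inj : injective rot.
  move=> [v s] [v' s'] [] /ffunP vv /mulIg ss; rewrite -ss; congr pair.
  by apply/ffunP => i; have := vv i; rewrite !ffunE /= ss => /addIr.
have oneE b : one b = b :> nat by rewrite /one /= modn_small; case: b => //.
have rot1 p i : ((rot p).1 i = (p.1 i + (p.2 i == 0 :> nat)) %% N.+1 :> nat)%N.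
  by rewrite /rot ffunE; exact: (congr1 (fun k => (p.1 i + k) %% N.+1)%N (oneE _)).
have rot2 p i : (rot p).2 i = r (p.2 i) by rewrite /rot /= permM.
have vert_rot p k : (k <= n)%N -> cells n.+1 p -> vert p k.+1 =1 vert (rot p) k.
  move=> kn /cellsP cp i; rewrite /vert rot1 rot2 rE modn_small; last first.
    by have [] := cp i; case: eqP; lia.
  by do 2?case: ifP; case: eqP; lia.
set A := \sum_(p | _) _; set B := \sum_(p | _) _.
have -> : A = \sum_(p | cells n.+1 p) full_det n (vert (rot p)).
  by apply: eq_bigr => p cp; apply: eq_full_det => k kn; exact: vert_rot.
have -> : B = \sum_(p | cells n.+1 (rot p)) full_det n (vert (rot p)).
  rewrite /B (reindex_inj rot_inj) /=; apply: eq_bigr => p cp.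
  by apply: eq_full_det => k kn i; rewrite /= /bump leqNgt ltnS kn.
rewrite [in RHS](reindex_inj rot_inj) /= !(big_mkcond (fun p => cells _ _)) /=.
(* The identity holds term by term: each of the three terms is 0 or the same facet value [G]. *)
rewrite -big_split /=; apply: eq_bigr => p _.
set G := full_det n _; set q := rot p.
(* [l] is the coordinate that [p] raises first; apart from the corner value at [l], the conditions
   of [cells n.+1] agree for [p] and [q]. *)
pose l : 'I_m := (p.2^-1)%g (Ordinal (leq_ltn_trans (leq0n n) nm)).
have pl : p.2 l = 0%N :> nat by rewrite permKV.
have p2l i : i != l -> p.2 i != 0%N :> nat.
  move=> il; apply: contra_neq il => p0; apply: (@perm_inj _ p.2).
  by apply: ord_inj; rewrite pl.
have ql : q.2 l = n :> nat by rewrite rot2 rE pl.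
have q1l : q.1 l = ((p.1 l).+1 %% N.+1)%N :> nat by rewrite rot1 pl addn1.
have q1 i : i != l -> q.1 i = p.1 i :> nat.
  by move=> /p2l il; rewrite rot1 (negPf il) addn0 modn_small.
pose base (p : cell) := [forall i, ((i != l) ==> (p.1 i < N)%N) &&
   ((n < i)%N ==> (p.1 i == 0 :> nat) && (p.2 i == i))].
have cb p' : cells n.+1 p' = base p' && (p'.1 l < N)%N.
  apply/cellsP/andP => [H|[/forallP H Hl] i].
    split; last by have [] := H l.
    apply/forallP => i; have [-> H2] := H i; rewrite implybT /=.
    by apply/implyP => /H2[-> ->]; rewrite !eqxx.
  have /andP[/implyP H1 /implyP H2] := H i; split=> [|/H2/andP[/eqP ? /eqP ?]//].
  by case: (eqVneq i l) => [->//|/H1].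
have bq : base q = base p.
  apply: eq_forallb => i; case: (eqVneq i l) => [->|il] /=.
    case: (ltnP n l) => // nl /=.
    have /negPf -> : q.2 l != l by apply/eqP => /(congr1 (@nat_of_ord m)); lia.
    have /negPf -> : p.2 l != l by apply/eqP => /(congr1 (@nat_of_ord m)); lia.
    by rewrite !andbF.
  rewrite q1 //; congr (_ && _); case: (ltnP n i) => // ni /=; congr (_ && _).
  have ri : r i = i by apply: ord_inj; rewrite rE ni.
  by rewrite rot2 -{2}ri (inj_eq perm_inj).
(* On this facet the coordinate [l] is constant: if it is [N], label 0 is missing; if it is 0, label
   [l.+1] is. *)
have G0N : q.1 l = N :> nat -> G = 0.
  move=> qN; apply/eqP; apply: contraT => /full_det_surj/(_ ord0)[k] /eqP.
  rewrite (negPf (@labN _ l _)) // /vert qN ql; have := ltn_ord k; lia.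
have G00 : q.1 l = 0%N :> nat -> (l < n)%N -> G = 0.
  move=> q0 ln; apply/eqP; apply: contraT => /full_det_surj.
  move=> /(_ (Ordinal (ln : l.+1 < n.+1)%N))[k] /eqP.
  rewrite (negPf (@lab0 _ l _)) // /vert q0 ql; have := ltn_ord k; lia.
have cnS : cells n q -> cells n.+1 q.
  move=> /cellsP cq; apply/cellsP => i; have [? H] := cq i; split=> // ni.
  by apply: H; lia.
have cn : cells n q -> q.1 l = 0%N :> nat.
  move=> /cellsP cq; have [_ H] := cq (Ordinal nm); have [|v0 s0] := H; first by [].
  rewrite -v0; congr (nat_of_ord (q.1 _)); apply: (@perm_inj _ q.2).
  by apply: ord_inj; rewrite s0 ql.
have cn' : cells n.+1 q -> q.1 l = 0%N :> nat -> ~~ (l < n)%N -> cells n q.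
  move=> /cellsP cq q0 ln; have le : l = Ordinal nm.
    apply: ord_inj => /=; apply/eqP; rewrite eqn_leq; apply/andP; split; last by lia.
    rewrite leqNgt; apply/negP => nl; have [_ /(_ nl)[_]] := cq l.
    by move=> /(congr1 (@nat_of_ord m)); rewrite ql; lia.
  apply/cellsP => i; have [? H] := cq i; split=> // ni.
  case: (ltngtP n i) ni => // [/H//|ni _].
  have -> : i = l by apply: ord_inj; rewrite le.
  by split=> //; apply: ord_inj; rewrite ql le.
move: cnS cn cn'; rewrite !cb bq; case: (base p) => /=; last first.
  by move=> H _ _; case: (cells n q) H => [/(_ isT)|]; rewrite ?addr0.
have pN := ltn_ord (p.1 l); have qN := ltn_ord (q.1 l); rewrite ltnS in pN qN.
(* If [p.1 l] is [N], the corner wraps round to the bottom face. Otherwise both cells count and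
   cancel, or [q] sticks out at the top, where [G] is 0. *)
case: (ltnP (p.1 l) N) => pl1; last first.
  have q0 : q.1 l = 0%N :> nat.
    by rewrite q1l (_ : (p.1 l).+1 = N.+1) ?modnn //; lia.
  rewrite q0 N0 => _ _ /(_ isT erefl); rewrite add0r.
  by case: (boolP (l < n)%N) => [/(G00 q0) -> _|_ ->//]; case: ifP.
have q0 : q.1 l = (p.1 l).+1 :> nat by rewrite q1l modn_small.
case: (cells n q) => [_ /(_ isT)|_ _ _]; first by rewrite q0.
case: ltnP => [_|qN']; first exact: F2_double.
by rewrite G0N ?addr0 //; apply/eqP; rewrite eqn_leq -ltnS qN.
Qed.

(** Induction on [n]: among the facets the middle ones cancel, and the end ones leave the sum one
    dimension below. In dimension 0 only the origin remains, with label 0. *)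
Lemma sum_full_det n : (n <= m)%N -> \sum_(p | cells n p) full_det n (vert p) = 1.
Proof.
elim: n => [_|n ih nm].
  pose z : cell := ([ffun=> ord0], 1%g).
  rewrite (big_pred1 z) => [|p]; last first.
    apply/cellsP/eqP => [H|-> i]; last by rewrite /= ffunE perm1.
    case: p H => v s H; congr pair.
      by apply/ffunP => i; rewrite ffunE; apply: ord_inj; have [_ []] := H i.
    by apply/permP => i; rewrite perm1; have [_ []] := H i.
  rewrite /full_det det_mx11 mxE (_ : lab _ = 0%N) //.
  apply/eqP; rewrite -leqn0; apply: (@lab_vert 0) => //.
  by apply/cellsP => i /=; rewrite ffunE perm1.
rewrite -(ih (ltnW nm)) -(sum_ends nm).
rewrite (eq_bigr (fun p => \sum_(j < n.+2) full_det n (vert p \o bump j))) => [|p cp].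
  rewrite exchange_big /= big_ord_recl big_ord_recr /=.
  congr (_ + _); rewrite [X in X + _]big1 ?add0r // => j _.
  by apply: sum_middle => //=; rewrite /bump; have := ltn_ord j; lia.
by apply: full_det_facets => k; exact: lab_vert.
Qed.

(** The sum being odd, some simplex carries all labels; only the grid cube around it is retained. *)
Lemma kuhn_sperner : exists v : 'I_m -> nat, (forall i, v i < N)%N /\
  forall a, (a <= m)%N ->
  exists2 x, lab x = a & forall i, (v i <= x i <= (v i).+1)%N.
Proof.
have [p cp D0] : exists2 p, cells m p & full_det m (vert p) != 0.
  apply: contrapT => H; have := sum_full_det (leqnn m).
  rewrite big1 => [/eqP|p cp]; first by rewrite eq_sym oner_eq0.
  by apply/eqP/negPn/negP => D0; apply: H; exists p.
exists (fun i => p.1 i); split=> [i|a am].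
  by move/cellsP: cp => /(_ i)[].
have [k ka] := full_det_surj D0 (Ordinal (am : (a < m.+1)%N)).
by exists (vert p k) => // i; rewrite /vert; case: (_ < _)%N; lia.
Qed.
End sperner.

(** * Covering dimension and boundaries *)

(* Covering dimension at most [m - 1], with the shift of [dim_t_lt]. *)
Definition covdim_lt (X : topologicalType) (m : nat) (F : set X) :=
  forall r (O : 'I_r -> set X), (forall i, open (O i)) ->
    F `<=` \bigcup_i O i ->
  exists V : 'I_r -> set X, [/\ forall i, open (V i), forall i, V i `<=` O i,
    F `<=` \bigcup_i V i &
    forall x, F x -> (#|[pred i | `[< V i x >]]| <= m)%N].

Section covering_topology.
Context {X : topologicalType}.
Implicit Types F G U : set X.

Lemma open_setD (A B : set X) : open A -> closed B -> open (A `\` B).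
Proof. by move=> oA cB; apply: openI => //; exact: closed_openC. Qed.

Lemma closed_boundary U : closed (boundary U).
Proof. by apply: closedI; [exact: closed_closure|exact/open_closedC/open_interior]. Qed.

Lemma covdim_lt_set0 m : covdim_lt m (set0 : set X).
Proof. by move=> r O oO _; exists O; split=> [i|i x|x []|x []] //; exact: oO. Qed.

(** The cover is refined along [F] and kept as it is off [F]; the outcome is refined along [G] in
    the same way. At points of [F] the second step stays inside the first refinement. *)
Lemma covdim_ltU m F G : closed F -> closed G -> covdim_lt m F -> covdim_lt m G ->
  covdim_lt m (F `|` G).
Proof.
move=> cF cG covF covG r O oO OFG.
have [V [oV VO VF Vm]] := covF _ _ oO (subset_trans (@subsetUl _ F G) OFG).
pose O1 i := V i `|` (O i `\` F).
have oO1 i : open (O1 i) by apply: openU => //; apply: open_setD.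
have O1O i : O1 i `<=` O i by move=> x [/VO|[]].
have O1FG : F `|` G `<=` \bigcup_i O1 i.
  move=> x FGx; have [Fx|nFx] := pselect (F x).
    by have [i _ Vx] := VF _ Fx; exists i => //; left.
  by have [i _ Ox] := OFG _ FGx; exists i => //; right.
have [V2 [oV2 V2O VG V2m]] := covG _ _ oO1 (subset_trans (@subsetUr _ F G) O1FG).
exists (fun i => V2 i `|` (O1 i `\` G)); split=> [i|i|x FGx|x FGx].
- by apply: openU => //; apply: open_setD.
- by move=> x [/V2O/O1O|[/O1O]].
- have [Gx|nGx] := pselect (G x).
    by have [i _ Vx] := VG _ Gx; exists i => //; left.
  by have [i _ Ox] := O1FG _ FGx; exists i => //; right.
- have [Gx|nGx] := pselect (G x).
    apply: leq_trans (V2m _ Gx); apply: subset_leq_card; apply/fintype.subsetP => i.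
    by rewrite !inE => -[Vx|[]].
  have Fx : F x by case: FGx.
  apply: leq_trans (Vm _ Fx); apply: subset_leq_card; apply/fintype.subsetP => i.
  by rewrite !inE => -[/V2O|[]] [Vx|[]].
Qed.

Lemma covdim_lt_bigU m (s : seq (set X)) :
  (forall F, F \in s -> closed F /\ covdim_lt m F) ->
  let U := [set x | exists2 F, F \in s & F x] in closed U /\ covdim_lt m U.
Proof.
elim: s => [|F s ih] sP /=.
  rewrite (_ : [set _ | _] = set0); first by split; [exact: closed0|exact: covdim_lt_set0].
  by apply/seteqP; split=> // x [].
have [|cU covU] := ih; first by move=> G Gs; apply: sP; rewrite inE Gs orbT.
have [|cF covF] := sP F; first by rewrite inE eqxx.
rewrite (_ : [set _ | _] = F `|` [set x | exists2 F, F \in s & F x]).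
  by split; [exact: closedU|exact: covdim_ltU].
apply/seteqP; split=> x /=.
  by move=> [G]; rewrite inE => /orP[/eqP->|Gs Gx]; [left|right; exists G].
move=> [Fx|[G Gs Gx]]; first by exists F => //; rewrite inE eqxx.
by exists G => //; rewrite inE Gs orbT.
Qed.

(* The first member containing a point, cut off from the closures of the
   previous ones, contains it as soon as no boundary does. *)
Lemma disjoint_pieces (s : seq (set X)) : (forall U, U \in s -> open U) ->
  exists E : set X -> set X, [/\ forall U, U \in s -> open (E U),
    forall U, U \in s -> E U `<=` U,
    forall x U U', U \in s -> U' \in s -> E U x -> E U' x -> U = U' &
    forall x U, U \in s -> U x -> (forall U', U' \in s -> ~ boundary U' x) ->
      exists2 U', U' \in s & E U' x].
Proof.
elim: s => [|U0 s ih] oS; first by exists id; split.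
have [|E [oE EU Einj EP]] := ih; first by move=> U Us; apply: oS; rewrite inE Us orbT.
exists (fun U => if U == U0 then U0 else E U `\` closure U0).
have oU0 : open U0 by apply: oS; rewrite inE eqxx.
split=> [U|U|x U U'|x U].
- rewrite inE; case: (eqVneq U U0) => //= _ Us; apply: open_setD; first exact: oE.
  exact: closed_closure.
- rewrite inE; case: (eqVneq U U0) => [-> _ x //|_ /= Us x []] /(EU _ Us) //.
- rewrite !inE; case: (eqVneq U U0) => [->|_] /=; case: (eqVneq U' U0) => [->|_] //=.
  + by move=> _ _ U0x [_]; case; apply: subset_closure.
  + by move=> _ _ [_ nU0] /subset_closure.
  + by move=> Us Us' [Ex _] [Ex' _]; exact: Einj Ex Ex'.
- move=> Us Ux bd; have [U0x|nU0x] := pselect (U0 x).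
    by exists U0; rewrite ?inE eqxx.
  have nclU0 : ~ closure U0 x.
    move=> clx; apply: (bd U0); first by rewrite inE eqxx.
    by split=> // /interior_subset.
  have {}Us : U \in s by move: Us; rewrite inE => /orP[/eqP UU0|//]; rewrite UU0 in Ux.
  have [|U' U's E'x] := EP _ _ Us Ux.
    by move=> U' U's; apply: bd; rewrite inE U's orbT.
  exists U'; first by rewrite inE U's orbT.
  case: (eqVneq U' U0) => [U'0|//]; rewrite U'0 in U's E'x.
  by case: nU0x; exact: (EU U0).
Qed.

(** Near-covering compactness is applied to the filter of finite subfamilies of [D], directed by
    inclusion. *)
Lemma compact_seq_cover (D : set (set X)) F : compact F ->
  (forall U, D U -> open U) -> (forall x, F x -> exists2 U, D U & U x) ->
  exists s : seq (set X), (forall U, U \in s -> D U) /\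
    forall x, F x -> exists2 U, U \in s & U x.
Proof.
move=> /compact_near_coveringP cF oD FD.
pose S : set (seq (set X)) := [set s : seq (set X) | forall U, U \in s -> D U].
pose T (s : seq (set X)) : set (seq (set X)) := [set t : seq (set X) | S t /\ {subset s <= t}].
have FT : Filter (filter_from S T).
  apply: filter_from_filter; first by exists [::].
  move=> s t sS tS; exists (s ++ t) => [U|u [uS stu]].
    by rewrite mem_cat => /orP[/sS|/tS].
  by split; split=> // U Us; apply: stu; rewrite mem_cat Us ?orbT.
have : \forall t \near filter_from S T, F `<=` [set x | exists2 U, U \in t & U x].
  apply: cF => x /FD[U DU Ux].
  exists (U, T [:: U]).
    split=> /=; first exact: open_nbhs_nbhs (conj (oD _ DU) Ux).
    by exists [:: U] => // V; rewrite inE => /eqP->.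
  by move=> [y t] [/= Uy [_ Ut]]; exists U => //; apply: Ut; rewrite inE.
move=> [s sS sT]; exists s; split=> // x Fx.
by apply: (sT s) Fx; split.
Qed.

End covering_topology.

Lemma covdim_lt_subtype (X : topologicalType) (A F : set X) m :
  covdim_lt m (set_val @^-1` F : set A) -> covdim_lt m (F `&` A).
Proof.
move=> covF r O oO OF.
have oO' i : open (set_val @^-1` O i : set A) by exists (O i).
have [x Fx|V [oV VO VF Vm]] := covF _ _ oO'.
  by have [|i _ Ox] := OF (set_val x); [split=> //; exact: set_valP|exists i].
have /choice[V' V'P] : forall i, exists W : set X, open W /\ set_val @^-1` W = V i.
  by move=> i; have [W oW WV] := oV i; exists W.
exists (fun i => O i `&` V' i); split=> [i|i|x [Fx Ax]|x [Fx Ax]].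
- by apply: openI => //; case: (V'P i).
- exact: subIsetl.
- pose y : A := exist _ x (mem_set Ax).
  have [i _ Vy] := VF y Fx; exists i => //; split; first exact: (VO _ _ Vy).
  by have [_ VE] := V'P i; move: Vy; rewrite -VE.
- pose y : A := exist _ x (mem_set Ax).
  apply: leq_trans (Vm y Fx); apply: subset_leq_card; apply/fintype.subsetP => i.
  rewrite !inE => -[_ Vx].
  by have [_ <-] := V'P i.
Qed.

(** * Covering dimension and bases of compact metric spaces *)

Section covering_metric.
Context {R : realType} {X : metricType R}.
Implicit Types F U : set X.

Lemma lebesgue_number r (V : 'I_r -> set X) F : compact F ->
  (forall i, open (V i)) -> F `<=` \bigcup_i V i ->
  exists2 e : R, 0 < e & forall x, F x -> exists i, ball x e `<=` V i.
Proof.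
move=> /compact_near_coveringP cF oV FV.
have : \forall e \near (0 : R)^'+, F `<=` [set x | exists i, ball x e `<=` V i].
  apply: cF => x Fx; have [i _ Vx] := FV _ Fx.
  have /nbhs_ballP[e /= e0 eV] := open_nbhs_nbhs (conj (oV i) Vx).
  exists (ball x (e / 2), [set d | d < e / 2]).
    split=> /=; first by apply: nbhsx_ballx; rewrite divr_gt0.
    by apply: nbhs_right_lt; rewrite divr_gt0.
  move=> [y d] [/= xy de]; exists i => z yz; apply: eV; rewrite (splitr e).
  by apply: ball_triangle xy _; apply: le_ball yz; exact: ltW.
move=> H; have : \forall e \near (0 : R)^'+, 0 < e by exact: nbhs_right_gt.
move=> /(filterI H) /filter_ex[e [He e0]]; by exists e.
Qed.

(** [W i] consists of balls of half a Lebesgue number [e] around points of [F] whose [e]-ball lies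
    in [V i]. Centres near a common point are within [e] of each other, so all indices at that point
    occur at a single point of [F]: the multiplicity is bounded on the whole space. *)
Lemma open_cover_expansion m r (V : 'I_r -> set X) F : compact F ->
  (forall i, open (V i)) -> F `<=` \bigcup_i V i ->
  (forall x, F x -> (#|[pred i | `[< V i x >]]| <= m)%N) ->
  exists W : 'I_r -> set X, [/\ forall i, open (W i), forall i, W i `<=` V i,
    F `<=` \bigcup_i W i & forall x, (#|[pred i | `[< W i x >]]| <= m)%N].
Proof.
move=> cF oV FV Vm; have [e e0 eV] := lebesgue_number cF oV FV.
have e20 : 0 < e / 2 by rewrite divr_gt0.
pose D i := [set b | F b /\ ball b e `<=` V i].
exists (fun i => \bigcup_(b in D i) (ball b (e / 2))°); split=> [i|i|x Fx|x].
- by apply: bigcup_open => b _; exact: open_interior.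
- move=> x [b [Fb bV] /interior_subset bx]; apply: bV; apply: le_ball bx.
  by rewrite ler_pdivrMr // ler_pMr // ler1n.
- have [i xV] := eV _ Fx; exists i => //; exists x => //.
  exact: nbhsx_ballx.
- have [->//|] := posnP #|[pred i | `[< (\bigcup_(b in D i) (ball b (e / 2))°) x >]]|.
  move=> /card_gt0P[i0]; rewrite inE => -[b0 [Fb0 _] /interior_subset b0x].
  apply: leq_trans (Vm _ Fb0); apply: subset_leq_card; apply/fintype.subsetP => i.
  rewrite !inE => -[b [Fb bV] /interior_subset bx]; apply: bV.
  by rewrite (splitr e); apply: ball_triangle bx _; exact: ball_sym.
Qed.

(** Along the boundaries of a finite subfamily of the basis, the hypothesis gives a refinement of
    multiplicity [m], which is thickened without raising it. Off the boundaries, [disjoint_pieces]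
    adds one more layer. *)
Lemma covdim_ltS m F (B : set (set X)) : compact [set: X] -> closed F -> basis B ->
  (forall U, B U -> covdim_lt m (F `&` boundary U)) -> covdim_lt m.+1 F.
Proof.
move=> cX cF [oB bB] covB r O oO FO.
have cptF (G : set X) : closed G -> compact G.
  by move=> cG; apply: (subclosed_compact cG cX) => ?.
pose D := [set U | B U /\ exists i, U `<=` O i].
have [t [tD Ft]] : exists t : seq (set X), (forall U, U \in t -> D U) /\
    forall x, F x -> exists2 U, U \in t & U x.
  apply: compact_seq_cover; [exact: cptF|by move=> U [/oB]|move=> x Fx].
  have [i _ Ox] := FO _ Fx.
  have [U [BU Ux] UO] := bB x (O i) (open_nbhs_nbhs (conj (oO i) Ox)).
  by exists U => //; split=> //; exists i.
(* [c] chooses an index for each member, so that pieces can be merged into a refinement indexed like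
   [O]. *)
have [c cP] : exists c : set X -> nat,
    forall U, U \in t -> exists2 i : 'I_r, c U = i & U `<=` O i.
  have /choice[c cP] : forall U, exists k : nat,
      U \in t -> exists2 i : 'I_r, k = i & U `<=` O i.
    move=> U; have [/tD[_ [i UO]]|//] := boolP (U \in t); last by exists 0%N.
    by exists i => _; exists i.
  by exists c.
have [|E [oE EU Einj EP]] := @disjoint_pieces _ t; first by move=> U /tD[/oB].
pose G := [set x | exists2 G, G \in [seq F `&` boundary U | U <- t] & G x].
have [cG covG] : closed G /\ covdim_lt m G.
  apply: covdim_lt_bigU => _ /mapP[U Ut ->]; split.
    by apply: closedI => //; exact: closed_boundary.
  by apply: covB; case: (tD _ Ut).
have GF : G `<=` F by move=> x [_ /mapP[U _ ->] []].
have [V [oV VO VG Vm]] := covG _ _ oO (subset_trans GF FO).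
have [W [oW WV WG Wm]] := open_cover_expansion (cptF _ cG) oV VG Vm.
pose P i := [set x | exists2 U, U \in t & c U = i /\ E U x].
exists (fun i : 'I_r => W i `|` P i); split=> [i|i|x Fx|x Fx].
- apply: openU => //.
  rewrite (_ : P i = \bigcup_(U in [set U | U \in t /\ c U = i]) E U).
    by apply: bigcup_open => U [Ut _]; exact: oE.
  by apply/seteqP; split=> x [U]; [move=> ? []; exists U|move=> []; exists U].
- move=> x [/WV/VO//|[U Ut [cU Ex]]]; have [j cj UO] := cP _ Ut.
  have -> : i = j by apply: ord_inj; rewrite -cU.
  by apply: UO; exact: (EU _ Ut).
- have [Gx|nGx] := pselect (G x).
    by have [i _ Wx] := WG _ Gx; exists i => //; left.
  have [U Ut Ux] := Ft _ Fx.
  have [|U' Ut' EU'] := EP _ _ Ut Ux.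
    move=> U' Ut' bd; apply: nGx; exists (F `&` boundary U') => //.
    exact: map_f.
  by have [j cj _] := cP _ Ut'; exists j => //; right; exists U'.
- have [[U Ut Ex]|nE] := pselect (exists2 U, U \in t & E U x); last first.
    apply: leqW; apply: leq_trans (Wm x); apply: subset_leq_card.
    apply/fintype.subsetP => i; rewrite !inE => -[//|[U Ut [_ Ex]]].
    by case: nE; exists U.
  have [j cj _] := cP _ Ut.
  apply: (@leq_trans #|[predU1 j & [pred i | `[< W i x >]]]|); last first.
    by rewrite cardU1 -add1n; apply: leq_add; [exact: leq_b1|exact: Wm].
  apply: subset_leq_card; apply/fintype.subsetP => i.
  rewrite [X in X -> _]inE => -[Wx|[U' Ut' [cU' Ex']]]; apply/predU1P.
    by right; rewrite inE.
  left; apply/ord_inj; rewrite -cU' -cj; congr c.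
  exact: Einj Ex' Ex.
Qed.

End covering_metric.

Lemma compact_subtype (X : topologicalType) (A : set X) :
  compact A -> compact [set: A].
Proof.
move=> cA F PF _; have [|p [Ap clp]] := cA (set_val @ F) _ _.
  by apply: (@filterS _ F _ setT) => [x _|]; [exact: set_valP|exact: filterT].
exists (exist _ p (mem_set Ap)); split=> // B C FB [_ [/= [W oW <-] Wp] WC].
have [|_ [[y By <-] Wy]] := clp (set_val @` B) W _ (open_nbhs_nbhs (conj oW Wp)).
  by apply: (@filterS _ F _ B) => // y By; exists y.
by exists y; split=> //; apply: WC.
Qed.

(** Covering dimension is bounded by small inductive dimension, by [covdim_ltS] along the recursion
    on boundaries. *)
Lemma dim_t_lt_covdim_lt (R : realType) (X : metricType R) m :
  compact [set: X] -> dim_t_lt m X -> covdim_lt m [set: X].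
Proof.
elim: m X => [|m ih] X cX /=; first by move=> ->; exact: covdim_lt_set0.
move=> [B bB BX]; apply: (covdim_ltS cX closedT bB) => U BU.
apply: covdim_lt_subtype; rewrite preimage_setT; apply: ih; last exact: BX.
apply: compact_subtype; apply: (subclosed_compact _ cX) => //.
exact: closed_boundary.
Qed.

(** Lebesgue's covering argument: the cover consists of the sets where one coordinate is positive
    and the set where all are below 1. Labelling each grid point by a member of the refinement
    containing a fixed ball around it meets Sperner's boundary conditions, and a grid cube with all
    [k.+1] labels has a corner in [k.+1] members. *)
Lemma cube_not_covdim_lt (R : realType) (X : metricType R) k (F : set X)
    (g : ('I_k -> R) -> X) (x : 'I_k -> X -> R) :
  compact F -> (forall i, continuous (x i)) ->
  (forall u, (forall i, 0 <= u i <= 1) -> F (g u) /\ forall i, x i (g u) = u i) ->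
  (forall u v e, 0 < e -> (forall i, `|u i - v i| < e) -> mdist (g u) (g v) < e) ->
  ~ covdim_lt k F.
Proof.
move=> cF cx gF gd covF.
pose O (a : 'I_k.+1) := if unlift ord0 a is Some i then [set p | 0 < x i p]
  else [set p | forall i, x i p < 1].
have oO a : open (O a).
  rewrite /O; case: (unlift _ _) => [i|].
    by apply: (@open_comp _ _ (x i) [set r | 0 < r]) => [p _|]; [exact: cx|exact: open_gt].
  rewrite openE => p /= xp; apply: filter_forall => i.
  apply: open_nbhs_nbhs; split=> //.
  by apply: (@open_comp _ _ (x i) [set r | r < 1]) => [q _|]; [exact: cx|exact: open_lt].
have FO : F `<=` \bigcup_a O a.
  move=> p Fp; have [[i xi]|nx] := pselect (exists i, 0 < x i p).
    by exists (lift ord0 i) => //; rewrite /O liftK.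
  exists ord0 => //; rewrite /O unlift_none /= => i.
  by rewrite ltNge; apply/negP => xi; apply: nx; exists i; exact: lt_le_trans xi.
have [V [oV VO VF Vk]] := covF _ _ oO FO.
have [e e0 eV] := lebesgue_number cF oV VF.
pose N := (Num.truncn e^-1).+1.
have NP : 0 < N%:R :> R by rewrite ltr0n.
have Ne : N%:R^-1 < e by rewrite invf_plt ?posrE //; exact: truncnS_gt.
(* Truncation at [N] gives every family of naturals a point of the cube, as [lab] must be total. *)
pose c (v : 'I_k -> nat) i : R := (minn (v i) N)%:R / N%:R.
have c01 v i : 0 <= c v i <= 1.
  rewrite divr_ge0 ?ler0n //= ler_pdivrMr // mul1r ler_nat; exact: geq_minr.
have gc v := gF (c v) (c01 v).
have /choice[lab labP] v : exists a, exists2 a' : 'I_k.+1, a = a' :> nat &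
    ball (g (c v)) e `<=` V a'.
  by have [a aV] := eV _ (gc v).1; exists a, a.
have labO v a : lab v = nat_of_ord a -> O a (g (c v)).
  have [a' -> aV /ord_inj <-] := labP v; apply: VO; apply: aV.
  exact: ballxx.
have [||v i vi|v i vi|v [_ vP]] := @kuhn_sperner k N lab.
- by [].
- by move=> v; have [a -> _] := labP v; rewrite -ltnS.
- apply/eqP => /(labO _ (lift ord0 i)); rewrite /O liftK /= (gc v).2 /c vi.
  by rewrite min0n mul0r ltxx.
- apply/eqP => /(labO _ ord0); rewrite /O unlift_none /= => /(_ i).
  by rewrite (gc v).2 /c vi minnn divff ?ltxx // pnatr_eq0.
have := Vk _ (gc v).1; rewrite leqNgt => /negP; apply.
apply: (@leq_trans #|'I_k.+1|); first by rewrite card_ord.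
apply: subset_leq_card.
apply/fintype.subsetP => a _; rewrite inE.
have [y ya vy] := vP a (leq_ord a).
have [a' + aV] := labP y; rewrite ya => /ord_inj aa'; rewrite aa'; apply: aV.
rewrite ballEmdist /=; apply: gd => // i; apply: le_lt_trans Ne.
rewrite /c -mulrBl normrM normfV [X in _ / X]gtr0_norm // ler_pdivrMr // mulVf ?gt_eqF //.
have := vy i; move: (v i) (y i) => m l ml.
have [/eqP|] : (minn l N = minn m N) \/ (minn l N = (minn m N).+1) by lia.
  by move=> /eqP ->; rewrite subrr normr0.
by move=> ->; rewrite -natr1 addrC addKr normr1.
Qed.

(** * Hausdorff measure *)

Local Open Scope ereal_scope.

Section hausdorff_basics.
Context {R : realType} {X : metricType R}.
Implicit Types (A U : set X) (s t e : R).

Lemma diam_le A r : (forall x y, A x -> A y -> (mdist x y <= r)%R) -> diam A <= r%:E.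
Proof.
by move=> H; apply: ge_ereal_sup => _ [[x y] [/= Ax Ay] <-]; rewrite lee_fin H.
Qed.

Lemma le_diam A x y : A x -> A y -> (mdist x y)%:E <= diam A.
Proof. by move=> Ax Ay; apply: ereal_sup_ubound; exists (x, y). Qed.

Lemma diam_ge0 A : A !=set0 -> 0 <= diam A.
Proof. by move=> [x Ax]; apply: le_trans (le_diam Ax Ax); rewrite lee_fin mdist_ge0. Qed.

Lemma diam_fin A e : A !=set0 -> diam A <= e%:E ->
  exists2 r : R, (0 <= r <= e)%R & diam A = r%:E.
Proof.
move=> /diam_ge0; case: (diam A) => [r| |]; rewrite ?lee_fin //.
by move=> r0 re; exists r; rewrite ?r0.
Qed.

Lemma diam_pow_ge0 s A : 0 <= diam_pow s A.
Proof. by rewrite /diam_pow; case: ifP => // _; exact: poweR_ge0. Qed.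

Lemma diam_pow_set0 s : diam_pow s (set0 : set X) = 0.
Proof. by rewrite /diam_pow eqxx. Qed.

Lemma diam_powE s A : A !=set0 -> diam_pow s A = diam A `^ s.
Proof. by move=> /set0P; rewrite /diam_pow => /negPf->. Qed.

Lemma diam_pow_le s A r : (0 <= s)%R -> (0 <= r)%R -> diam A <= r%:E ->
  diam_pow s A <= (r `^ s)%:E.
Proof.
move=> s0 r0 Ar; have [->|/set0P An] := eqVneq A set0.
  by rewrite diam_pow_set0 lee_fin powR_ge0.
rewrite diam_powE //; have [d /andP[d0 dr] ->] := diam_fin An Ar.
by rewrite lee_fin ge0_ler_powR // nnegrE.
Qed.

Lemma hausdorff_measure_ge0 s A : 0 <= hausdorff_measure s A.
Proof.
apply: le_ereal_sup_tmp; exists (hausdorff_content s 1 A); first by exists 1%R => /=.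
by apply: le_ereal_inf_tmp => _ [U _ <-]; apply: nneseries_ge0 => *; exact: diam_pow_ge0.
Qed.

Lemma hausdorff_measure_le s A M :
  (forall e, (0 < e)%R -> exists2 U : (set X)^nat,
    A `<=` \bigcup_i U i /\ (forall i, diam (U i) <= e%:E) &
    \sum_(0 <= i <oo) diam_pow s (U i) <= M) -> hausdorff_measure s A <= M.
Proof.
move=> H; apply: ge_ereal_sup => _ [e /= e0 <-]; have [U UP UM] := H _ e0.
by apply: ge_ereal_inf; exists (\sum_(0 <= i <oo) diam_pow s (U i)) => //; exists U.
Qed.

Lemma hausdorff_measure_lt s A M e : (0 < e)%R -> hausdorff_measure s A < M ->
  exists2 U : (set X)^nat,
    A `<=` \bigcup_i U i /\ (forall i, diam (U i) <= e%:E) &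
    \sum_(0 <= i <oo) diam_pow s (U i) < M.
Proof.
move=> e0 AM; have : hausdorff_content s e A < M.
  by apply: le_lt_trans AM; apply: ereal_sup_ubound; exists e.
by move=> /ereal_inf_lt[_ [U UP <-] UM]; exists U.
Qed.

Lemma hausdorff_measure_eq0P s A : hausdorff_measure s A = 0 <->
  (forall e e', (0 < e)%R -> (0 < e')%R -> exists2 U : (set X)^nat,
    A `<=` \bigcup_i U i /\ (forall i, diam (U i) <= e%:E) &
    \sum_(0 <= i <oo) diam_pow s (U i) <= e'%:E).
Proof.
split=> [A0 e e' e0 e'0|H].
  have [|U UP /ltW] := @hausdorff_measure_lt s A e'%:E e e0; last by exists U.
  by rewrite A0 lte_fin.
apply/eqP; rewrite eq_le hausdorff_measure_ge0 andbT.
apply/lee_addgt0Pr => e' e'0; rewrite add0e; apply: hausdorff_measure_le => e e0.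
exact: H.
Qed.

(** A finite cover is padded with the empty set, for which [diam_pow] is 0 even at exponent 0. *)
Lemma hausdorff_content_seq s e A (L : seq (set X)) M :
  (forall x, A x -> exists2 U, U \in L & U x) ->
  (forall U, U \in L -> diam U <= e%:E) ->
  \sum_(U <- L) diam_pow s U <= M ->
  exists2 U : (set X)^nat,
    A `<=` \bigcup_i U i /\ (forall i, diam (U i) <= e%:E) &
    \sum_(0 <= i <oo) diam_pow s (U i) <= M.
Proof.
move=> AL Le LM; exists (nth set0 L).
  split=> [x /AL[U UL Ux]|i].
    by exists (index U L) => //; rewrite nth_index.
  have [iL|Li] := ltnP i (size L); first exact/Le/mem_nth.
  by rewrite nth_default //; apply: ge_ereal_sup => _ [[x y] [[]]].
apply: le_trans LM; rewrite (nneseries_split 0%N (size L)); last first.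
  by move=> *; exact: diam_pow_ge0.
rewrite add0n [X in _ + X]eseries0 ?adde0; last first.
  by move=> i Li _; rewrite nth_default // diam_pow_set0.
by rewrite -(big_nth set0 xpredT (diam_pow s)).
Qed.

Lemma hausdorff_measure_mono s t A : (0 <= s)%R -> (s < t)%R ->
  hausdorff_measure s A < +oo -> hausdorff_measure t A = 0.
Proof.
move=> s0 st Afin; apply/hausdorff_measure_eq0P => e e' e0 e'0.
have [M M0 AM] : exists2 M : R, (0 < M)%R & hausdorff_measure s A < M%:E.
  move: (hausdorff_measure_ge0 s A) Afin; case: (hausdorff_measure s A) => [r| |] //.
  by rewrite lee_fin => r0 _; exists (r + 1)%R; rewrite ?ltr_wpDl // lte_fin ltrDl.
have ts0 : (0 < t - s)%R by rewrite subr_gt0.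
(* Sets of diameter at most [d] have their [t]-th power bounded by d^(t-s) times the [s]-th; [d] is
   chosen so that d^(t-s) M is at most [e']. *)
pose d := Num.min e ((e' / M) `^ (t - s)^-1)%R.
have d0 : (0 < d)%R by rewrite lt_min e0 powR_gt0 // divr_gt0.
have dM : (d `^ (t - s) * M <= e')%R.
  rewrite -ler_pdivlMr //.
  apply: (@le_trans _ _ (((e' / M) `^ (t - s)^-1) `^ (t - s))%R).
    by apply: ge0_ler_powR; rewrite ?nnegrE ?powR_ge0 ?(ltW d0) ?(ltW ts0) // ge_min lexx orbT.
  by rewrite -powRrM mulVf ?gt_eqF // powRr1 // divr_ge0 // ltW.
have [U [AU Ud] UM] := hausdorff_measure_lt d0 AM.
exists U; first by split=> // i; apply: le_trans (Ud i) _; rewrite lee_fin ge_min lexx.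
apply: (@le_trans _ _ (\sum_(0 <= i <oo) (d `^ (t - s))%:E * diam_pow s (U i))).
  apply: lee_nneseries => i *; first exact: diam_pow_ge0.
  have [->|/set0P Un] := eqVneq (U i) set0; first by rewrite !diam_pow_set0 mule0.
  rewrite !diam_powE //; have [r /andP[r0 rd] ->] := diam_fin Un (Ud i).
  rewrite /= -EFinM lee_fin; have [->|rn0] := eqVneq r 0%R.
    by rewrite (@powR0 _ t) ?mulr_ge0 ?powR_ge0 // gt_eqF // (le_lt_trans s0).
  rewrite (_ : r `^ t = r `^ (t - s) * r `^ s)%R; last first.
    by rewrite -powRD ?rn0 ?implybT // subrK.
  by rewrite ler_wpM2r ?powR_ge0 // ge0_ler_powR ?nnegrE // ltW.
rewrite nneseriesZl; last by move=> *; exact: diam_pow_ge0.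
apply: (@le_trans _ _ ((d `^ (t - s))%:E * M%:E)).
  by apply: lee_wpmul2l; [rewrite lee_fin powR_ge0|exact: ltW].
by rewrite -EFinM lee_fin.
Qed.

(** The [i]-th set is covered at cost e' / 2^(i+1); a bijection between the naturals and pairs
    merges the covers, and the nonnegative double series may be rearranged. *)
Lemma hausdorff_null_bigcup s (A : (set X)^nat) :
  (forall i, hausdorff_measure s (A i) = 0) ->
  hausdorff_measure s (\bigcup_i A i) = 0.
Proof.
move=> A0; apply/hausdorff_measure_eq0P => e e' e0 e'0.
have /choice[U UP] i : exists U : (set X)^nat,
   [/\ A i `<=` \bigcup_j U j, forall j, diam (U j) <= e%:E &
    \sum_(0 <= j <oo) diam_pow s (U j) <= (e' / (2 ^ i.+1)%:R)%:E].
  have ei : (0 < e' / (2 ^ i.+1)%:R)%R by rewrite divr_gt0 // ltr0n expn_gt0.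
  have /hausdorff_measure_eq0P/(_ _ _ e0 ei)[U [? ?] ?] := A0 i.
  by exists U.
have /card_esym/ppcard_eqP[f] := card_nat2.
pose a (p : nat * nat) := diam_pow s (U p.1 p.2).
exists (fun k => U (f k).1 (f k).2).
  split=> [x [i _]|k]; last by have [_ + _] := UP (f k).1; exact.
  have [+ _ _] := UP i => /[apply] -[j _ Ux].
  by exists (f^-1%FUN (i, j)) => //=; rewrite invK ?inE.
apply: le_trans (epsilon_trick0 xpredT (ltW e'0)).
rewrite nneseries_esumT; last by move=> *; exact: diam_pow_ge0.
rewrite -(@reindex_esum _ _ _ setT setT f a); last exact: bij.
have a0 p : 0 <= a p by exact: diam_pow_ge0.
rewrite (_ : setT = setT `*`` (fun=> setT)); last by apply/seteqP; split.
rewrite (_ : esum _ _ = \esum_(p in setT `*`` (fun=> setT)) diam_pow s (U p.1 p.2)) //.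
rewrite -(@esum_esum _ _ _ setT (fun=> setT) (fun i j => diam_pow s (U i j))); last first.
  by move=> *; exact: diam_pow_ge0.
rewrite -nneseries_esumT; last first.
  by move=> *; apply: esum_ge0 => *; exact: diam_pow_ge0.
apply: lee_nneseries => i *.
  by apply: esum_ge0 => *; exact: diam_pow_ge0.
rewrite -nneseries_esumT; last by move=> *; exact: diam_pow_ge0.
by have [_ _] := UP i.
Qed.

End hausdorff_basics.

Lemma hausdorff_measure_lipschitz (R : realType) (X Y : metricType R) (f : X -> Y)
    s (A : set X) (B : set Y) : (0 <= s)%R ->
  (forall x y, (mdist (f x) (f y) <= mdist x y)%R) -> B `<=` f @` A ->
  hausdorff_measure s B <= hausdorff_measure s A.
Proof.
move=> s0 fL BA; apply: ge_ereal_sup => _ [e /= e0 <-].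
apply: le_ereal_sup_tmp; exists (hausdorff_content s e A); first by exists e.
apply: le_ereal_inf_tmp => _ [U [AU Ue] <-].
have fU i : diam (f @` U i) <= diam (U i).
  apply: ge_ereal_sup => _ [[_ _] [/= [x Ux <-] [y Uy <-]] <-].
  by apply: (@le_trans _ _ (mdist x y)%:E); [rewrite lee_fin fL|exact: le_diam].
apply: ge_ereal_inf; exists (\sum_(0 <= i <oo) diam_pow s (f @` U i)).
  exists (fun i => f @` U i) => //; split=> [y /BA[x Ax <-]|i].
    by have [i _ Ux] := AU _ Ax; exists i => //; exists x.
  exact: le_trans (Ue i).
apply: lee_nneseries => [*|i _]; first exact: diam_pow_ge0.
have [U0|/set0P Un] := eqVneq (U i) set0.
  by rewrite U0 image_set0 !diam_pow_set0.
have [r /andP[r0 re] Ur] := diam_fin Un (Ue i).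
rewrite (diam_powE _ Un) Ur; apply: diam_pow_le => //.
by rewrite -Ur.
Qed.

(** * Lower bounds from fibres *)

(** Level [n] is a finite cover by members of [B] lying in balls of radius 1/(n+1), so the levels
    together still form a basis. *)
Lemma countable_subbasis (R : realType) (X : metricType R) (B : set (set X)) :
  compact [set: X] -> basis B -> exists s : nat -> seq (set X),
    (forall n U, U \in s n -> B U) /\ basis [set U | exists n, U \in s n].
Proof.
move=> cX [oB bB].
pose D n := [set U | B U /\ exists x, U `<=` ball x (n.+1%:R^-1 : R)].
have /choice[s sP] n : exists s : seq (set X), (forall U, U \in s -> D n U) /\
    forall x, [set: X] x -> exists2 U, U \in s & U x.
  apply: compact_seq_cover cX _ _ => [U [/oB]//|x _].
  have [|U [BU Ux] UO] := bB x (ball x (n.+1%:R^-1 : R)).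
    by apply: nbhsx_ballx; rewrite invr_gt0.
  by exists U => //; split=> //; exists x.
exists s; split=> [n U /(sP n).1[]//|]; split=> [U [n] /(sP n).1[/oB]//|x V].
move=> /nbhs_ballP[e /= e0 eV].
pose n := Num.truncn (e / 2)^-1.
have ne : (n.+1%:R^-1 < e / 2)%R.
  by rewrite invf_plt ?posrE ?divr_gt0 // truncnS_gt.
have [U Un Ux] := (sP n).2 x Logic.I.
exists U; first by split=> //; exists n.
have [_ [y Uy]] := (sP n).1 _ Un.
apply: subset_trans eV => z Uz; rewrite (splitr e).
apply: (@ball_triangle _ _ y); first by apply/ball_sym/(le_ball (ltW ne))/Uy.
exact/(le_ball (ltW ne))/Uy.
Qed.

Lemma hausdorff_measure_subset (R : realType) (X : metricType R) s (A B : set X) :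
  (0 <= s)%R -> B `<=` A -> hausdorff_measure s B <= hausdorff_measure s A.
Proof.
move=> s0 BA; apply: (@hausdorff_measure_lipschitz _ _ _ id) => //.
by rewrite image_id.
Qed.

Lemma hausdorff_measure_set0 (R : realType) (X : metricType R) s :
  hausdorff_measure s (set0 : set X) = 0.
Proof.
apply/hausdorff_measure_eq0P => e e' e0 e'0.
by apply: (@hausdorff_content_seq _ _ _ _ _ [::]) => //; rewrite big_nil lee_fin ltW.
Qed.

Lemma hausdorff_measure_neq0 (R : realType) (X : metricType R) s (A : set X) :
  hausdorff_measure s A != 0 -> A !=set0.
Proof.
by move=> A0; apply/set0P; apply: contra_neq A0 => ->; exact: hausdorff_measure_set0.
Qed.

(* The fibres over all points of [S] stay non-trivial in the boundary of one
   of countably many basic open sets, uniformly over a non-null part of [S]. *)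
Lemma dim_tH_ge (R : realType) (C : metricType R) (t : R) j (X : metricType R)
    (p : X -> C) (S : set C) : (0 <= t)%R -> compact [set: X] ->
  (forall x y, (mdist (p x) (p y) <= mdist x y)%R) ->
  hausdorff_measure t S != 0 ->
  (forall c, S c -> ~ covdim_lt j (p @^-1` [set c])) ->
  (t + j%:R)%:E <= dim_tH j X.
Proof.
move=> t0; elim: j X p S => [|j ih] X p S cX pL S0 Scov.
  (* With no boundary left to take, the fibres are merely non-empty; the 1-Lipschitz image of the
     space then contains the non-null set [S]. *)
  have Sp : S `<=` p @` setT.
    move=> c /Scov H; apply: contrapT => Nc; apply: H.
    rewrite (_ : _ @^-1` _ = set0); first exact: covdim_lt_set0.
    by apply/seteqP; split=> // x xc; apply: Nc; exists x.
  have X0 : ([set: X] == set0) = false.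
    have [c /Sp[x _ _]] := hausdorff_measure_neq0 S0.
    by apply/negbTE/set0P; exists x.
  rewrite addr0 /= /dim_H X0; apply: le_ereal_inf_tmp => _ [s [s0 sX] <-].
  rewrite lee_fin leNgt; apply/negP => /(hausdorff_measure_mono s0)/(_ sX) X0'.
  have := hausdorff_measure_lipschitz t0 pL Sp; rewrite X0' => H.
  by case/negP: S0; rewrite eq_le H hausdorff_measure_ge0.
have [c0 Sc0] := hausdorff_measure_neq0 S0.
have X0 : ([set: X] == set0) = false.
  apply/negP => /eqP X0; apply: (Scov _ Sc0).
  rewrite (_ : _ @^-1` _ = set0); first exact: covdim_lt_set0.
  by apply/seteqP; split=> // x _; rewrite -X0.
rewrite /= X0; apply: le_ereal_inf_tmp => d [B /(countable_subbasis cX)[s [sB bs]] Bd].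
(* Membership of [U] in [s n] is part of [T], so that it can be read off once [T n U] is
   non-null. *)
pose T n U := [set c | S c /\ (U \in s n /\ ~ covdim_lt j (p @^-1` [set c] `&` boundary U))].
have [n [U TU]] : exists n U, hausdorff_measure t (T n U) != 0.
  apply: contrapT => H; case/eqP: S0.
  have : hausdorff_measure t (\bigcup_n \bigcup_i T n (nth set0 (s n) i)) = 0.
    apply: hausdorff_null_bigcup => n; apply: hausdorff_null_bigcup => i.
    by apply: contrapT => /eqP T0; apply: H; exists n, (nth set0 (s n) i).
  move=> H0; apply/eqP; rewrite eq_le hausdorff_measure_ge0 -H0 andbT.
  apply: hausdorff_measure_subset => // c Sc.
  (* If every boundary met the fibre over [c] in too small a set, [covdim_ltS] would make the fibre
     itself too small. *)
  apply: contrapT => Nc; apply: (Scov _ Sc).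
  have cp : continuous p.
    move=> x V /nbhs_ballP[e /= e0 eV]; apply/nbhs_ballP; exists e => // y xy.
    by apply: eV; move: xy; rewrite !ballEmdist /=; exact: le_lt_trans.
  apply: (covdim_ltS cX _ bs).
    apply: closed_comp; first by move=> ? _; exact: cp.
    exact/accessible_closed_set1/hausdorff_accessible/metric_hausdorff.
  move=> U [n Un]; apply: contrapT => NU; apply: Nc.
  by exists n => //; exists (index U (s n)) => //; rewrite nth_index //; split.
have [c [Sc [Un _]]] := hausdorff_measure_neq0 TU.
have := Bd _ (sB _ _ Un).
have : (t + j%:R)%:E <= dim_tH j (boundary U : metricType R).
  apply: (ih _ (p \o set_val) (T n U)) => //.
  - apply: compact_subtype; apply: (subclosed_compact _ cX) => //.
    exact: closed_boundary.
  - by move=> x y; exact: pL.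
  - by move=> c' [_ [_ N]] H; apply: N; exact: covdim_lt_subtype.
move=> /le_trans/[apply].
case: d {Bd} => [r| |] //; last by move=> _; exact: leey.
by rewrite -EFinB !lee_fin lerBrDr -natr1 addrA.
Qed.

(** * Words with a gauge, times a cube *)

Local Open Scope ring_scope.

(* Words first differing at letter [m] will be at distance [2 `^ (- g m)]; as there are
   [2 ^ m] cylinders of level [m], the last two clauses make [s] the dimension. *)
Lemma dimension_exponent (R : realType) (s : \bar R) : (0 <= s)%E ->
  exists g : nat -> R, [/\ forall m, 0 <= g m,
    {homo g : m m' / (m <= m')%N >-> m <= m'},
    forall x, exists m, x < g m,
    forall u : R, (s < u%:E)%E -> exists M0, forall M, (M0 <= M)%N -> M%:R <= u * g M &
    forall t : R, 0 <= t -> (t%:E <= s)%E -> exists b, forall M, t * g M <= M%:R + b].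
Proof.
case: s => [r| |] //; last first.
  (* Infinite dimension: the radii shrink more slowly than any exponential. *)
  move=> _; exists (fun m => Num.sqrt m%:R); split=> [m|m m' mm'|x|//|t t0 _].
  - exact: sqrtr_ge0.
  - by rewrite ler_sqrt ?ler_nat // ler0n.
  - exists (Num.truncn (x ^+ 2)).+1; have [x0|x0] := ltP x 0.
      by apply: lt_le_trans x0 _; exact: sqrtr_ge0.
    by rewrite -[X in X < _](ger0_norm x0) -sqrtr_sqr ltr_sqrt ?ltr0n // truncnS_gt.
  (* Completing the square: t x - x^2 is at most t^2/4, here with x the square root of [M]. *)
  - exists (t ^+ 2 / 4) => M; have := sqr_sqrtr (ler0n R M).
    have := sqr_ge0 (Num.sqrt M%:R - t / 2); nra.
rewrite lee_fin le_eqVlt => /predU1P[<-|r0].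
  (* Dimension 0: the radii shrink faster than any exponential. *)
  exists (fun m => m%:R ^+ 2); split=> [m|m m' mm'|x|u|t t0].
  - exact: sqr_ge0.
  - by rewrite ler_pXn2r ?nnegrE ?ler0n // ler_nat.
  - exists (Num.truncn x).+1; apply: lt_le_trans (truncnS_gt x) _.
    by rewrite expr2 ler_peMl ?ler0n // ler1n.
  - rewrite lte_fin => u0; exists (Num.truncn u^-1).+1 => M MM.
    have uM : 1 <= u * M%:R.
      rewrite -ler_pdivrMl // mulr1; apply: le_trans (ltW (truncnS_gt _)) _.
      by rewrite ler_nat.
    by rewrite expr2 mulrA ler_peMl.
  - rewrite lee_fin => t0'; exists 0 => M.
    by rewrite (_ : t = 0) ?mul0r ?addr0 //; apply/eqP; rewrite eq_le t0 t0'.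
(* Finite positive dimension [r]: 2^m cylinders of size 2^(-m/r). *)
exists (fun m => m%:R / r); split=> [m|m m' mm'|x|u|t t0].
- by rewrite divr_ge0 // ltW.
- by rewrite ler_pM2r ?invr_gt0 // ler_nat.
- exists (Num.truncn (x * r)).+1; rewrite ltr_pdivlMr //; exact: truncnS_gt.
- rewrite lte_fin => ru; exists 0%N => M _.
  by rewrite mulrCA ler_peMr // ler_pdivlMr // mul1r ltW.
- rewrite lee_fin => tr; exists 0 => M.
  by rewrite addr0 mulrCA ler_piMr // ler_pdivrMr // mul1r.
Qed.

(* A point is a tag [k <= n], an infinite binary word and [n] reals; [g k] is the
   exponent of the gauge by which the distance of two words of tag [k] decays. *)
Definition tagspace {R : realType} {n : nat} (g : 'I_n.+1 -> nat -> R) : Type :=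
  ('I_n.+1 * (nat -> bool) * ('I_n -> R))%type.

HB.instance Definition _ {R : realType} {n} (g : 'I_n.+1 -> nat -> R) :=
  gen_eqMixin (tagspace g).
HB.instance Definition _ {R : realType} {n} (g : 'I_n.+1 -> nat -> R) :=
  gen_choiceMixin (tagspace g).

(** * A metric on tagged words with coordinates *)

Section space_metric.
Context {R : realType} {n : nat} {g : 'I_n.+1 -> nat -> R}.
Implicit Types p q : tagspace g.

Definition ptag p : 'I_n.+1 := p.1.1.
Definition pword p : nat -> bool := p.1.2.
Definition pcoord p : 'I_n -> R := p.2.

Lemma space_eqP p q : ptag p = ptag q -> pword p =1 pword q -> pcoord p =1 pcoord q ->
  p = q.
Proof.
by case: p q => [[? ?] ?] [[? ?] ?]; rewrite /ptag /pword /pcoord /= => -> /funext-> /funext->.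
Qed.

(* The absolute value makes the radius at most 1 without any assumption on [g]. *)
Definition word_radius k m : R := 2 `^ (- `|g k m|).

Lemma word_radius_gt0 k m : 0 < word_radius k m.
Proof. exact: powR_gt0. Qed.

Lemma word_radius_le1 k m : word_radius k m <= 1.
Proof. by rewrite -(powRr0 2); apply: ler_powR; rewrite ?ler1n // oppr_le0. Qed.

(** The distance is the supremum of these numbers, with 0 keeping the set non-empty. When [g] is
    nondecreasing, the word part is the radius at the first differing letter; the metric axioms hold
    for any [g]. *)
Let gaps p q : set R := [set r | [\/ r = 0, ptag p <> ptag q /\ r = 1,
  exists m, [/\ ptag p = ptag q, pword p m <> pword q m & r = word_radius (ptag p) m] |
  exists i, r = `|pcoord p i - pcoord q i|]].

Let gaps_sup p q : has_sup (gaps p q).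
Proof.
split; first by exists 0; apply: Or41.
exists (1 + \sum_i `|pcoord p i - pcoord q i|) => r.
have S0 : 0 <= \sum_i `|pcoord p i - pcoord q i| by exact: sumr_ge0.
case=> [->|[_ ->]|[m [_ _ ->]]|[i ->]].
- by rewrite addr_ge0.
- by rewrite lerDl.
- by apply: le_trans (word_radius_le1 _ _) _; rewrite lerDl.
- rewrite (bigD1 i) //= addrCA lerDl addr_ge0 //; exact: sumr_ge0.
Qed.

Definition space_dist p q : R := sup (gaps p q).

Lemma space_distP p q r : space_dist p q <= r <->
  [/\ 0 <= r, ptag p <> ptag q -> 1 <= r,
   forall m, ptag p = ptag q -> pword p m <> pword q m -> word_radius (ptag p) m <= r &
   forall i, `|pcoord p i - pcoord q i| <= r].
Proof.
split=> [H|[r0 tr wr cr]].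
  have ub x : gaps p q x -> x <= r.
    by move=> Gx; apply: le_trans H; apply: sup_upper_bound (gaps_sup _ _) _ Gx.
  split=> [|t|m t w|i]; apply: ub.
  - exact: Or41.
  - exact: Or42.
  - by apply: Or43; exists m.
  - by apply: Or44; exists i.
apply: ge_sup; first by have [] := gaps_sup p q.
by move=> x [->|[/tr ? ->]|[m [t w ->]]|[i ->]] //; exact: wr.
Qed.

Let space_dist_ge0 p q : 0 <= space_dist p q.
Proof. by have /space_distP[] := lexx (space_dist p q). Qed.

Let space_distxx p : space_dist p p = 0.
Proof.
apply/eqP; rewrite eq_le space_dist_ge0 andbT; apply/space_distP.
by split=> // i; rewrite subrr normr0.
Qed.

Let space_dist_positivity p q : space_dist p q = 0 -> p = q.
Proof.
move=> pq; have /space_distP[_ t w c] : space_dist p q <= 0 by rewrite pq.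
have tpq : ptag p = ptag q by apply: contrapT => /t; rewrite ler10.
apply: space_eqP => // [m|i].
  by apply: contrapT => /(w _ tpq); apply/negP; rewrite -ltNge word_radius_gt0.
by apply/eqP; rewrite -subr_eq0 -normr_le0.
Qed.

Let space_dist_le_sym p q : space_dist p q <= space_dist q p.
Proof.
have /space_distP[r0 t w c] := lexx (space_dist q p).
apply/space_distP; split=> [//|tpq|m tpq wpq|i].
- by apply: t => /esym/tpq.
- by rewrite tpq; apply: w => // /esym/wpq.
- by rewrite distrC.
Qed.

Let space_dist_sym p q : space_dist p q = space_dist q p.
Proof. by apply/eqP; rewrite eq_le !space_dist_le_sym. Qed.

Let space_dist_triangle q p p' :
  space_dist p p' <= space_dist p q + space_dist q p'.
Proof.
have /space_distP[r0 t w c] := lexx (space_dist p q).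
have /space_distP[r0' t' w' c'] := lexx (space_dist q p').
(* A change of tag on the way costs at least 1, and no word radius exceeds 1. *)
have tq k : k <= 1 -> ptag p <> ptag q \/ ptag q <> ptag p' ->
    k <= space_dist p q + space_dist q p'.
  move=> k1 [/t ?|/t' ?]; apply: le_trans k1 _; first by rewrite ler_wpDr.
  by rewrite ler_wpDl.
apply/space_distP; split=> [|tpp'|m tpp' wpp'|i].
- by rewrite addr_ge0.
- apply: tq => //; have [<-|] := pselect (ptag p = ptag q); by [right|left].
- have [tpq|npq] := pselect (ptag p = ptag q); last first.
    by apply: tq; [exact: word_radius_le1|left].
  have [wpq|wpq] := pselect (pword p m = pword q m); last first.
    by apply: ler_wpDr => //; exact: w.
  by apply: ler_wpDl => //; rewrite tpq; apply: w'; rewrite -?tpq // -wpq.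
- have -> : pcoord p i - pcoord p' i = (pcoord p i - pcoord q i) + (pcoord q i - pcoord p' i).
    by ring.
  by apply: le_trans (ler_normD _ _) _; exact: lerD.
Qed.

HB.instance Definition _ := isMetric.Build R (tagspace g)
  space_distxx space_dist_positivity space_dist_sym space_dist_triangle.

Lemma mdist_spaceP p q r : mdist p q <= r <->
  [/\ 0 <= r, ptag p <> ptag q -> 1 <= r,
   forall m, ptag p = ptag q -> pword p m <> pword q m -> word_radius (ptag p) m <= r &
   forall i, `|pcoord p i - pcoord q i| <= r].
Proof. exact: space_distP. Qed.

Lemma mdist_coord p q i : `|pcoord p i - pcoord q i| <= mdist p q.
Proof. by have /mdist_spaceP[] := lexx (mdist p q). Qed.

Lemma mdist_tag p q : mdist p q < 1 -> ptag p = ptag q.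
Proof.
have /mdist_spaceP[_ t _ _] := lexx (mdist p q).
by move=> pq; apply: contrapT => /t; rewrite leNgt pq.
Qed.

Lemma mdist_word p q m : ptag p = ptag q -> mdist p q < word_radius (ptag p) m ->
  pword p m = pword q m.
Proof.
have /mdist_spaceP[_ _ w _] := lexx (mdist p q).
by move=> t pq; apply: contrapT => /(w _ t); rewrite leNgt pq.
Qed.

Lemma pcoord_continuous i : continuous (fun p => pcoord p i).
Proof.
move=> p U /nbhs_ballP[e /= e0 eU]; apply/nbhs_ballP; exists e => // q.
by rewrite ballEmdist => pq; apply: eU; apply: le_lt_trans (mdist_coord _ _ _) pq.
Qed.

End space_metric.
Arguments word_radius {R n} g k m.

(** * Balls and compact blocks of the tagged space *)

Section space_topology.
Context {R : realType} {n : nat} {g : 'I_n.+1 -> nat -> R}.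
Context (g_ge0 : forall k m, 0 <= g k m).
Context (g_homo : forall k, {homo g k : m m' / (m <= m')%N >-> m <= m'}).
Context (g_unbounded : forall k x, exists m, x < g k m).
Implicit Types p q : tagspace g.

Lemma word_radiusE k m : word_radius g k m = 2 `^ (- g k m).
Proof. by rewrite /word_radius ger0_norm. Qed.

Lemma word_radius_homo k m m' : (m <= m')%N -> word_radius g k m' <= word_radius g k m.
Proof.
by move=> mm'; rewrite !word_radiusE; apply: ler_powR; rewrite ?ler1n // lerN2 g_homo.
Qed.

Lemma word_radius_small k e : 0 < e -> exists M, forall m, (M <= m)%N -> word_radius g k m < e.
Proof.
move=> e0; have [M gM] := g_unbounded k (- ln e / ln 2).
have ln20 : 0 < ln 2 :> R by rewrite ln_gt0 // ltr1n.
exists M => m Mm; apply: le_lt_trans (word_radius_homo k Mm) _.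
rewrite word_radiusE /powR pnatr_eq0 /= -[ltRHS](@lnK _ e) ?posrE // ltr_expR.
by rewrite mulNr ltrNl -ltr_pdivrMr.
Qed.

Lemma mdist_le p q M r : ptag p = ptag q -> (forall m, (m < M)%N -> pword p m = pword q m) ->
  word_radius g (ptag p) M <= r -> (forall i, `|pcoord p i - pcoord q i| <= r) ->
  mdist p q <= r.
Proof.
move=> t w Mr c; apply/mdist_spaceP; split=> // [|m _ wm].
  by apply: le_trans Mr; exact/ltW/word_radius_gt0.
apply: le_trans Mr; apply: word_radius_homo; rewrite leqNgt; apply/negP => /w; exact: wm.
Qed.

(** Here the words agree up to and including letter [M], one letter more than [mdist_le] asks
    for. *)
Lemma mdist_radius p q M : mdist p q < word_radius g (ptag p) M ->
  ptag p = ptag q /\ forall m, (m <= M)%N -> pword p m = pword q m.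
Proof.
move=> pq; have t : ptag p = ptag q by exact/mdist_tag/(lt_le_trans pq)/word_radius_le1.
split=> // m mM; apply: mdist_word => //; apply: lt_le_trans pq _.
exact: word_radius_homo.
Qed.

(** The block is an image of a product that is compact by Tychonoff; the map is continuous because
    the radii tend to 0, so that a ball only constrains finitely many letters. *)
Lemma compact_block k (A : 'I_n -> set R) : (forall i, compact (A i)) ->
  compact [set p : tagspace g | ptag p = k /\ forall i, A i (pcoord p i)].
Proof.
move=> cA; pose T1 := prod_topology (fun _ : nat => bool).
pose T2 := prod_topology (fun _ : 'I_n => R).
pose f (x : T1 * T2) : tagspace g := (k, x.1, x.2).
pose B : set T2 := [set x | forall i, A i (x i)].
have cB : compact B by exact: tychonoff.
have cT : compact [set: T1].
  have := @tychonoff nat (fun=> bool) (fun=> setT) (fun=> bool_compact).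
  by congr compact; apply/seteqP; split.
rewrite (_ : [set p | _] = f @` ([set: T1] `*` B)); last first.
  apply/seteqP; split=> [[[k' z] x] [/= tk Ax]|_ [x [_ Bx] <-]].
    by exists (z, x) => //; rewrite /f /= -tk.
  by split=> // i; exact: Bx.
apply: continuous_compact; last exact: compact_setX.
apply: continuous_subspaceT => -[z x] U /nbhs_ballP[e /= e0 eU].
have e20 : 0 < e / 2 by rewrite divr_gt0.
have [M /(_ _ (leqnn M)) Me] := word_radius_small k e20.
have Hz : nbhs (z : T1) [set z' : T1 | forall i : 'I_M, z' i = z i].
  apply: (@filter_forall T1 'I_M (fun i => [set z' : T1 | z' i = z i])
    (nbhs (z : T1)) (nbhs_filter _)) => i.
  have := @proj_continuous nat (fun=> bool) i z [set z i].
  by apply; exact: (open_nbhs_nbhs (conj (discrete_open _) _)).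
have Hx : nbhs (x : T2) [set x' : T2 | forall i, `|x i - x' i| < e / 2].
  apply: (@filter_forall T2 'I_n (fun i => [set x' : T2 | `|x i - x' i| < e / 2])
    (nbhs (x : T2)) (nbhs_filter _)) => i.
  have := @proj_continuous 'I_n (fun=> R) i x (ball (x i) (e / 2)).
  by apply; exact: nbhsx_ballx.
exists ([set z' : T1 | forall i : 'I_M, z' i = z i],
  [set x' : T2 | forall i, `|x i - x' i| < e / 2]) => //.
move=> [z' x'] [/= zz xx]; apply: eU; rewrite ballEmdist /=.
apply: (@le_lt_trans _ _ (e / 2)); last by rewrite ltr_pdivrMr // ltr_pMr // ltr1n.
apply: (@mdist_le _ _ M) => // [m mM||i]; last exact: ltW.
  by rewrite /pword /= (zz (Ordinal mM)).
exact: ltW.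
Qed.

End space_topology.

(** * Mass distribution on the words *)

(** The weights below the two possible first letters add up to less than 1, so one of them, doubled,
    is still less than 1; the word [z] goes that way and the argument repeats on the tails. An empty
    word would already weigh 1. *)
Lemma kraft_avoid (R : realFieldType) M (L : seq (seq bool)) :
  (forall w, w \in L -> (size w <= M)%N) -> \sum_(w <- L) 2 ^- size w < 1 :> R ->
  exists z : nat -> bool, forall w, w \in L ->
    exists2 m, (m < size w)%N & z m <> nth false w m.
Proof.
elim: M L => [|M ih] L LM L1.
  exists (fun=> false) => w wL; have := LM _ wL; rewrite leqn0 size_eq0 => /eqP w0.
  by move: L1; rewrite (big_rem _ wL) /= w0 expr0 invr1 gtrDl ltNge sumr_ge0.
pose Lb b := [seq behead w | w <- L & head false w == b].
have L0 w : w \in L -> (0 < size w)%N.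
  move=> wL; rewrite lt0n size_eq0; apply/eqP => w0.
  by move: L1; rewrite (big_rem _ wL) /= w0 expr0 invr1 gtrDl ltNge sumr_ge0.
have half b : \sum_(w <- Lb b) 2 ^- size w =
    2 * \sum_(w <- L | head false w == b) 2 ^- size w :> R.
  rewrite big_map big_filter mulr_sumr big_seq_cond [RHS]big_seq_cond.
  apply: eq_bigr => w /andP[/L0 w0 _]; rewrite size_behead -{2}(prednK w0).
  by rewrite exprS invfM mulrA divff ?mul1r // pnatr_eq0.
have [b Lb1] : exists b, \sum_(w <- Lb b) 2 ^- size w < 1 :> R.
  have : (\sum_(w <- Lb true) 2 ^- size w < 1 :> R) ||
         (\sum_(w <- Lb false) 2 ^- size w < 1 :> R).
    rewrite !half; move: L1; rewrite (bigID (fun w => head false w == true)) /=.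
    rewrite [X in _ + X](eq_bigl (fun w => head false w == false)).
      by move=> L1; apply/orP; case: ltP; [left|right; lra].
    by move=> w; case: (head false w).
  by case/orP; [exists true|exists false].
have [|z zL] := ih _ _ Lb1.
  move=> _ /mapP[w + ->]; rewrite mem_filter => /andP[_ /LM wM].
  by rewrite size_behead; lia.
exists (fun m => if m is m'.+1 then z m' else b) => w wL.
have [hb|/eqP hb] := eqVneq (head false w) b; last first.
  by exists 0%N; [exact: L0|rewrite nth0; exact/nesym].
have [|m ml zm] := zL (behead w); first by apply: map_f; rewrite mem_filter hb eqxx.
exists m.+1; first by move: ml; rewrite size_behead; lia.
by move: zm; rewrite nth_behead.
Qed.

Local Open Scope ereal_scope.

Section mass_distribution.
Context {R : realType} {n : nat} {g : 'I_n.+1 -> nat -> R}.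
Context (g_ge0 : forall k m, (0 <= g k m)%R).
Context (g_homo : forall k, {homo g k : m m' / (m <= m')%N >-> (m <= m')%R}).
Context (g_unbounded : forall k x, exists m, (x < g k m)%R).

Definition word_set k : set (tagspace g) := [set p | ptag p = k /\ pcoord p = fun=> 0%R].

Definition cylinder k (w : seq bool) : set (tagspace g) :=
  [set p | ptag p = k /\ forall m, (m < size w)%N -> pword p m = nth false w m].

Lemma open_cylinder k w : open (cylinder k w).
Proof.
rewrite openE => p [tp wp]; apply/nbhs_ballP; exists (word_radius g k (size w)).
  exact: word_radius_gt0.
move=> q; rewrite ballEmdist /= -tp => /(mdist_radius g_ge0 g_homo)[tq wq].
by split=> [|m mw]; rewrite -?tq // -wq ?wp // ltnW.
Qed.

Lemma compact_word_set k : compact (word_set k).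
Proof.
rewrite (_ : word_set k = [set p | ptag p = k /\ forall i, [set 0%R] (pcoord p i)]).
  apply: (compact_block g_ge0 g_homo g_unbounded (A := fun=> [set 0%R])) => i.
  exact: compact_set1.
apply/seteqP; split=> p [tp cp]; split=> //; first by move=> i; rewrite cp.
by apply/funext.
Qed.

(* A set of diameter [word_radius g k m] sits in a cylinder of level [m]; a
   one-point set has to be put in a cylinder of an arbitrarily high level. *)
Lemma cylinder_cover k t b (U : set (tagspace g)) e : (0 <= t)%R -> (0 < e)%R ->
  (forall M, t * g k M <= M%:R + b)%R ->
  exists w, U `&` word_set k `<=` cylinder k w /\
    (2 `^ (- b) * 2 ^- size w)%:E <= diam_pow t U + e%:E.
Proof.
move=> t0 e0 gb; set c := (2 `^ (- b))%R; have c0 : (0 < c)%R by exact: powR_gt0.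
have [M Me] : exists M, (c * 2 ^- M <= e)%R.
  exists (Num.truncn (c / e)).+1; rewrite ler_pdivrMr ?exprn_gt0 // mulrC.
  rewrite -ler_pdivrMr // (le_trans (ltW (truncnS_gt _))) // -natrX ler_nat.
  exact/ltnW/ltn_expl.
have [[u [Uu Su]]|N] := pselect (U `&` word_set k !=set0); last first.
  exists (nseq M false); split; first by move=> p Up; case: N; exists p.
  by rewrite size_nseq -[leLHS]add0e; apply: leeD; rewrite ?lee_fin // diam_pow_ge0.
pose D m := exists2 p, (U `&` word_set k) p & pword p m <> pword u m.
have pre m : (forall m', (m' < m)%N -> ~ D m') ->
    U `&` word_set k `<=` cylinder k (mkseq (pword u) m).
  move=> H p Up; split; first by case: Up => _ [].
  move=> m'; rewrite size_mkseq => m'm; rewrite nth_mkseq //.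
  by apply: contrapT => wp; apply: (H _ m'm); exists p.
have [[m Dm]|ND] := pselect (exists m, D m); last first.
  exists (mkseq (pword u) M); split; first by apply: pre => m' _ Dm'; apply: ND; exists m'.
  by rewrite size_mkseq -[leLHS]add0e; apply: leeD; rewrite ?lee_fin // diam_pow_ge0.
(* [m'] is the first letter at which some point of the trace departs from [u]. *)
have /ex_minnP[m' /asboolP[p [Up Sp] wp] m'min] : exists m, `[< D m >].
  by exists m; apply/asboolP.
exists (mkseq (pword u) m'); split.
  apply: pre => m'' lt /asboolP/m'min; lia.
rewrite size_mkseq -[leLHS]adde0; apply: leeD; last by rewrite lee_fin ltW.
have dU : (word_radius g k m')%:E <= diam U.
  apply: le_trans (le_diam Up Uu); rewrite lee_fin.
  have /mdist_spaceP[_ _ + _] := lexx (mdist p u).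
  by move=> /(_ m'); rewrite Sp.1 Su.1; apply.
rewrite diam_powE; last by exists u.
apply: (@le_trans _ _ ((word_radius g k m')%:E `^ t)); last first.
  apply: gt0_ler_poweR => //; rewrite in_itv /= ?leey ?andbT ?lee_fin.
    exact/ltW/word_radius_gt0.
  by apply: le_trans dU; rewrite lee_fin; exact/ltW/word_radius_gt0.
(* In exponents, the claim reads t g(m') <= m' + b. *)
rewrite poweR_EFin lee_fin word_radiusE // -powRrM /c.
rewrite -[(2 ^- m')%R](@powR_invn R 2 m') // -powRD ?pnatr_eq0 ?implybT //.
by apply: ler_powR; [rewrite ler1n|have := gb m'; lra].
Qed.

(** A cover of cost at most c/4 is traded for cylinders at an extra cost c/4. Finitely many of these
    suffice by compactness, and their weights 2^(-length) add up to at most 1/2, so [kraft_avoid]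
    finds a word outside all of them. *)
Lemma word_set_measure_neq0 k t b : (0 <= t)%R ->
  (forall M, t * g k M <= M%:R + b)%R ->
  hausdorff_measure t (word_set k) != 0.
Proof.
move=> t0 gb; apply/eqP => /hausdorff_measure_eq0P.
set c := (2 `^ (- b))%R; have c0 : (0 < c)%R by exact: powR_gt0.
have c40 : (0 < c / 4)%R by rewrite divr_gt0.
move=> /(_ _ _ ltr01 c40)[U [SU _] UM].
have /choice[w wP] i : exists w, U i `&` word_set k `<=` cylinder k w /\
    (c * 2 ^- size w)%:E <= diam_pow t (U i) + (c / 4 / (2 ^ i.+1)%:R)%:E.
  by apply: cylinder_cover => //; rewrite divr_gt0 // ltr0n expn_gt0.
have [N SN] : exists N, word_set k `<=` [set p | exists2 i, (i < N)%N & cylinder k (w i) p].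
  have /compact_near_coveringP/(_ nat \oo
    (fun N p => exists2 i, (i < N)%N & cylinder k (w i) p)) := @compact_word_set k.
  case=> [p Sp|N _ /(_ N (leqnn N)) H]; last by exists N.
  have [i _ Up] := SU _ Sp.
  have cp : cylinder k (w i) p by apply: (wP i).1.
  exists (cylinder k (w i), [set N | (i < N)%N]).
    split=> /=; first by apply: open_nbhs_nbhs; split=> //; exact: open_cylinder.
    by exists i.+1.
  by move=> [q N] [/= cq iN]; exists i.
have sum1 : (\sum_(i < N) 2 ^- size (w i) < 1 :> R)%R.
  have : \sum_(i < N) (c * 2 ^- size (w i))%:E <= (c / 4 + c / 4)%:E.
    apply: (@le_trans _ _ (\sum_(i < N) (diam_pow t (U i) + (c / 4 / (2 ^ i.+1)%:R)%:E))).
      by apply: lee_sum => i _; exact: (wP i).2.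
    rewrite big_split /= EFinD; apply: leeD.
      apply: le_trans UM; rewrite -(big_mkord xpredT (fun i => diam_pow t (U i))).
      by apply: nneseries_lim_ge => *; exact: diam_pow_ge0.
    apply: le_trans (epsilon_trick0 xpredT (ltW c40)).
    rewrite -(big_mkord xpredT (fun i => (c / 4 / (2 ^ i.+1)%:R)%:E)).
    by apply: nneseries_lim_ge => i *; rewrite lee_fin divr_ge0 // ltW.
  rewrite sumEFin lee_fin -mulr_sumr; set S := (\sum_(i < N) _)%R; nra.
have [M MP] : exists M, forall i, (i < N)%N -> (size (w i) <= M)%N.
  exists (\max_(i < N) size (w i)) => i iN.
  exact: (leq_bigmax_cond (Ordinal iN)).
have [v||z zP] := @kraft_avoid R M [seq w i | i <- iota 0 N].
- by move=> /mapP[i + ->]; rewrite mem_iota => /MP.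
- rewrite big_map; move: sum1.
  by rewrite -(big_mkord xpredT (fun i => 2 ^- size (w i))%R) /index_iota subn0.
pose p : tagspace g := (k, z, fun=> 0%R).
have [|i iN [_ wp]] := SN p; first by [].
have [|m mw] := zP (w i); first by apply: map_f; rewrite mem_iota.
by rewrite -wp.
Qed.

End mass_distribution.

(** * Upper bounds on strata *)

Local Open Scope ring_scope.

Lemma avoid_seq (R : realFieldType) (Q : seq R) (x y : R) : x < y ->
  exists2 a, x < a < y & a \notin Q.
Proof.
move=> xy; suff [x' [y' [xx' xy' yy' H]]] : exists x' y', [/\ x <= x', x' < y', y' <= y &
    forall a, x' < a < y' -> a \notin Q].
  exists ((x' + y') / 2); last by apply: H; rewrite !midf_lt.
  by rewrite (le_lt_trans xx') ?(lt_le_trans _ yy') ?midf_lt.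
elim: Q => [|q Q [x' [y' [xx' xy' yy' H]]]]; first by exists x, y.
have [/andP[xq qy]|nq] := boolP (x' < q < y').
  exists x', q; split=> // [|a /andP[xa aq]]; first by apply: le_trans yy'; exact: ltW.
  by rewrite inE negb_or (lt_eqF aq) H // xa (lt_trans aq).
exists x', y'; split=> // a axy; rewrite inE negb_or H // andbT.
by apply: contraNneq nq => <-.
Qed.

Section strata.
Context {R : realType} {n : nat} {g : 'I_n.+1 -> nat -> R}.
Context (g_ge0 : forall k m, 0 <= g k m).
Context (g_homo : forall k, {homo g k : m m' / (m <= m')%N >-> m <= m'}).
Context (g_unbounded : forall k x, exists m, x < g k m).

(** [l] counts the boundaries taken so far, and [Q] collects 0 and the endpoints of the boxes used;
    coordinates outside [Q] are the free ones. *)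
Definition stratum l (Q : seq R) : set (tagspace g) :=
  [set p | (forall i, 0 <= pcoord p i <= 1) /\
    (#|[pred i | pcoord p i \notin Q]| + l <= ptag p)%N].

Section box.
Context {X : metricType R} (f : X -> tagspace g).
Context (f_iso : forall x y, mdist (f x) (f y) = mdist x y).

(** Iterated boundaries are nested subtypes; an isometry [f] into the tagged space allows boxes in
    all of them at once. *)
Definition box k (w : nat -> bool) M (a b : 'I_n -> R) : set X :=
  [set x | [/\ ptag (f x) = k, forall m, (m < M)%N -> pword (f x) m = w m &
    forall i, a i < pcoord (f x) i < b i]].

Lemma box_near k w M a b x :
  (forall i, pcoord (f x) i != a i /\ pcoord (f x) i != b i) ->
  \forall y \near x, box k w M a b y <-> box k w M a b x.
Proof.
move=> xab.
have cf i : (pcoord (f y) i @[y --> x] --> pcoord (f x) i).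
  move=> U /nbhs_ballP[e /= e0 eU]; apply/nbhs_ballP; exists e => // y.
  by rewrite ballEmdist /= -f_iso => /(le_lt_trans (mdist_coord _ _ i)) /eU.
have lt_near i c : pcoord (f x) i != c ->
    \forall y \near x, (pcoord (f y) i < c) = (pcoord (f x) i < c).
  rewrite neq_lt => /orP[xc|cx]; near=> y.
    by rewrite xc; near: y; exact: cvgr_lt (cf i) _ xc.
  by rewrite !ltNge (ltW cx) ltW //; near: y; exact: cvgr_gt (cf i) _ cx.
have gt_near i c : pcoord (f x) i != c ->
    \forall y \near x, (c < pcoord (f y) i) = (c < pcoord (f x) i).
  rewrite neq_lt => /orP[xc|cx]; near=> y.
    by rewrite !ltNge (ltW xc) ltW //; near: y; exact: cvgr_lt (cf i) _ xc.
  by rewrite cx; near: y; exact: cvgr_gt (cf i) _ cx.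
have H1 : \forall y \near x, forall i,
    (a i < pcoord (f y) i < b i) = (a i < pcoord (f x) i < b i).
  apply: filter_forall => i; have [xa xb] := xab i.
  near=> y; congr (_ && _); near: y; [exact: gt_near|exact: lt_near].
have H2 : \forall y \near x, ptag (f x) = ptag (f y) /\
    forall m, (m <= M)%N -> pword (f x) m = pword (f y) m.
  apply/nbhs_ballP; exists (word_radius g (ptag (f x)) M); first exact: word_radius_gt0.
  by move=> y; rewrite ballEmdist /= -f_iso => /(mdist_radius g_ge0 g_homo).
near=> y; have E : forall i, (a i < pcoord (f y) i < b i) = (a i < pcoord (f x) i < b i).
  by near: y.
have [tE wE] : ptag (f x) = ptag (f y) /\
    forall m, (m <= M)%N -> pword (f x) m = pword (f y) m.
  by near: y.
split=> -[t w' c]; split=> [|m mM|i]; rewrite -?t ?tE -?w' ?wE // -?E ?c //.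
- exact: ltnW.
- exact: ltnW.
- by rewrite E.
Unshelve. all: by end_near. Qed.

Lemma open_box k w M a b : open (box k w M a b).
Proof.
rewrite openE => x bx; have [_ _ abx] := bx.
have xab i : pcoord (f x) i != a i /\ pcoord (f x) i != b i.
  by have /andP[ax xb] := abx i; rewrite gt_eqF // lt_eqF.
by apply: filterS (box_near k w M xab) => y [_]; exact.
Qed.

Lemma boundary_box k w M a b x : boundary (box k w M a b) x ->
  exists i, pcoord (f x) i \in [:: a i; b i].
Proof.
move=> [clx nx]; apply: contrapT => N.
have xab i : pcoord (f x) i != a i /\ pcoord (f x) i != b i.
  apply/andP; rewrite -negb_or; apply/negP => H; apply: N; exists i.
  by rewrite !inE.
have H := box_near k w M xab; have [y [by_ /= Hy]] := clx _ H.
by apply: nx; move: (open_box k w M a b); rewrite openE; apply; exact: Hy.1.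
Qed.

Lemma stratum_basis l Q : (forall x, stratum l Q (f x)) ->
  exists2 B : set (set X), basis B & forall U, B U ->
    exists Q', forall x, boundary U x -> stratum l.+1 Q' (f x).
Proof.
move=> fQ; exists [set U | open U /\
    exists Q', forall x, boundary U x -> stratum l.+1 Q' (f x)]; last by move=> U [].
split=> [U []//|x V /nbhs_ballP[e /= e0 eV]].
have e20 : 0 < e / 2 by rewrite divr_gt0.
set k := ptag (f x); set c := pcoord (f x).
have [M /(_ _ (leqnn M)) Me] := word_radius_small g_ge0 g_homo g_unbounded k e20.
have /choice[a aP] i : exists a, c i - e / 2 < a < c i /\ a \notin Q.
  by have [|a ? ?] := @avoid_seq _ Q (c i - e / 2) (c i); [rewrite ltrBlDr ltrDl|exists a].
have /choice[b bP] i : exists b, c i < b < c i + e / 2 /\ b \notin Q.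
  by have [|b ? ?] := @avoid_seq _ Q (c i) (c i + e / 2); [rewrite ltrDl|exists b].
exists (box k (pword (f x)) M a b); first split; last 2 first.
- split=> // i; have [/andP[_ ->] _] := aP i; by have [/andP[-> _] _] := bP i.
- move=> y [ty wy cy]; apply: eV; rewrite ballEmdist /= -f_iso.
  apply: (@le_lt_trans _ _ (e / 2)); last by rewrite ltr_pdivrMr // ltr_pMr // ltr1n.
  apply: (@mdist_le _ _ _ g_ge0 g_homo _ _ M) => // [m mM||i].
  + by rewrite wy.
  + exact: ltW.
  + have := cy i; have [+ _] := aP i; have [+ _] := bP i; rewrite /c ler_norml; lra.
split; first exact: open_box.
exists (Q ++ codom a ++ codom b) => y By.
have [i0 yi0] := boundary_box By; have [c01 cQ] := fQ y; split=> //.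
apply: leq_trans cQ; rewrite addnS -addSn leq_add2r; apply: proper_card.
apply/properP; split.
  by apply/fintype.subsetP => i; rewrite !inE !mem_cat negb_or => /andP[].
have yab : pcoord (f y) i0 \in codom a ++ codom b.
  by move: yi0; rewrite !inE mem_cat => /orP[] /eqP->; rewrite codom_f ?orbT.
exists i0; rewrite !inE; last by rewrite mem_cat yab orbT.
by move: yi0; rewrite !inE => /orP[] /eqP->; [case: (aP i0)|case: (bP i0)].
Qed.
End box.
End strata.

(** * Box counting on strata *)

Section box_counting.
Context {R : realType} {n : nat} {g : 'I_n.+1 -> nat -> R}.
Context (g_ge0 : forall k m, 0 <= g k m).
Context (g_homo : forall k, {homo g k : m m' / (m <= m')%N >-> m <= m'}).
Context (g_unbounded : forall k x, exists m, x < g k m).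
Context {X : metricType R} (f : X -> tagspace g).
Context (f_iso : forall x y, mdist (f x) (f y) = mdist x y).

(* The coordinates of a point lying in the finite set [Q] are recorded exactly,
   the at most [k - l] others by a cell of side [word_radius g k M]. *)
Lemma stratum_cover l Q (k : 'I_n.+1) t e : (forall x, stratum l Q (f x)) ->
  0 <= t -> 0 < e ->
  ((l <= k)%N -> exists M0, forall M, (M0 <= M)%N -> M%:R <= (t - (k - l)%:R) * g k M) ->
  exists L : seq (set X), [/\
    forall x, ptag (f x) = k -> exists2 U, U \in L & U x,
    forall U, U \in L -> (diam U <= e%:E)%E &
    (\sum_(U <- L) diam_pow t U <= (2 ^ n * (size Q).+1 ^ n * 2 ^ n)%N%:R%:E)%E].
Proof.
move=> fQ t0 e0 gt; have [lk|kl] := leqP l k; last first.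
  exists [::]; split=> // [x xk|]; last by rewrite big_nil lee_fin.
  by have [_] := fQ x; rewrite xk; lia.
have {gt}[M0 gt] := gt lk.
have [M1 M1e] := word_radius_small g_ge0 g_homo g_unbounded k e0.
pose M := maxn M0 M1; set h := (k - l)%N in gt.
pose r := word_radius g k M.
have re : r < e by apply: M1e; exact: leq_maxr.
have r0 : 0 < r := word_radius_gt0 _ _.
have r1 : r <= 1 := word_radius_le1 _ _.
have gM : M%:R <= (t - h%:R) * g k M by apply: gt; exact: leq_maxl.
pose G := Num.truncn r^-1.
(* A code lists the first [M] letters, the set of free coordinates, positions in [Q] for the other
   coordinates and cells for the free ones. *)
pose I := (M.-tuple bool * {set 'I_n} * {ffun 'I_n -> 'I_(size Q).+1} * h.-tuple 'I_G.+1)%type.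
pose ci (P : {set 'I_n}) (c : h.-tuple 'I_G.+1) i : nat := nth ord0 c (index i (enum P)).
pose Z (j : I) : set X := [set x | [/\ ptag (f x) = k,
  forall m, (m < M)%N -> pword (f x) m = nth false j.1.1.1 m &
  forall i, if i \in j.1.1.2 then (ci j.1.1.2 j.2 i)%:R * r <= pcoord (f x) i <=
      (ci j.1.1.2 j.2 i).+1%:R * r
    else pcoord (f x) i == nth 0 Q (j.1.2 i)]].
have dZ j : (diam (Z j) <= r%:E)%E.
  apply: diam_le => x y [tx wx cx] [ty wy cy]; rewrite -f_iso.
  apply: (@mdist_le _ _ _ g_ge0 g_homo _ _ M) => [|m mM||i].
  - by rewrite tx ty.
  - by rewrite wx // wy.
  - by rewrite tx.
  - have := cx i; have := cy i; case: ifP => _; last first.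
      by move=> /eqP-> /eqP->; rewrite subrr normr0 ltW.
    rewrite -natr1; set a := _%:R; set u := pcoord _ i; set v := pcoord _ i.
    by rewrite mulrDl mul1r ler_norml => /andP[? ?] /andP[? ?]; lra.
exists [seq Z j | j <- enum {: I}]; split=> [x xk|_ /mapP[j _ ->]|].
- have [c01 cQ] := fQ x.
  pose P := [set i | pcoord (f x) i \notin Q]%SET.
  have Ph : (size (enum P) <= h)%N.
    rewrite -cardE /h; move: cQ; rewrite xk; set N1 := #|_|; set N2 := #|_|.
    have -> : N2 = N1 by apply: eq_card => i; rewrite !inE.
    lia.
  pose cell i : 'I_G.+1 := inord (Num.truncn (pcoord (f x) i / r)).
  have cellE i : cell i = Num.truncn (pcoord (f x) i / r) :> nat.
    rewrite inordK // ltnS; apply: le_truncn; rewrite ler_pdivrMr // mulVf ?gt_eqF //.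
    by have /andP[] := c01 i.
  (* There may be fewer than [h] free coordinates; the list of cells is padded to length [h]. *)
  pose s := [seq cell i | i <- enum P] ++ nseq (h - size (enum P)) ord0.
  have sz : size s == h by rewrite size_cat size_map size_nseq subnKC.
  pose a := [ffun i => inord (index (pcoord (f x) i) Q) : 'I_(size Q).+1].
  pose w := [tuple pword (f x) m | m < M].
  exists (Z (w, P, a, Tuple sz)); first by apply: map_f; rewrite mem_enum.
  split=> //= [m mM|i].
    by rewrite -[in RHS](tnth_nth false w (Ordinal mM)) tnth_mktuple.
  case: ifP => iP; last first.
    rewrite ffunE; move: iP; rewrite !inE => /negbFE iQ.
    by rewrite inordK ?nth_index // ltnS index_size.
  rewrite /ci /= nth_cat size_map index_mem mem_enum iP (nth_map i) ?index_mem ?mem_enum //.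
  have /truncn_itv/andP[T1 T2] : 0 <= pcoord (f x) i / r.
    by rewrite divr_ge0 ?(ltW r0) //; have /andP[] := c01 i.
  rewrite nth_index ?mem_enum // cellE; apply/andP; split.
    by rewrite -ler_pdivlMr.
  by rewrite -ler_pdivrMr // ltW.
- by apply: le_trans (dZ j) _; rewrite lee_fin ltW.
rewrite big_map; apply: (@le_trans _ _ (\sum_(j <- enum {: I}) (r `^ t)%:E)%E).
  by apply: lee_sum => j _; apply: diam_pow_le => //; exact: ltW.
rewrite sumEFin lee_fin big_enum /= sumr_const -[leLHS]mulr_natl.
have -> : #|{: I}| = (2 ^ M * 2 ^ n * (size Q).+1 ^ n * G.+1 ^ h)%N.
  rewrite !card_prod !card_tuple card_bool card_ffun !card_ord.
  by rewrite -cardsT -powersetT card_powerset cardsT card_ord.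
have hn : (h <= n)%N by rewrite /h; have := ltn_ord k; lia.
(* Each free coordinate has at most 2/r cells, so the factor r^h absorbs their number up to a
   constant. *)
have Gr : (G.+1 ^ h)%:R * r ^+ h <= (2 ^ n)%:R :> R.
  apply: (@le_trans _ _ (2 ^+ h)); last by rewrite -natrX ler_nat leq_exp2l.
  rewrite natrX -exprMn lerXn2r ?nnegrE ?mulr_ge0 // ?(ltW r0) //.
  have /truncn_itv/andP[T1 _] : 0 <= r^-1 by rewrite invr_ge0 ltW.
  have Gr1 : G%:R * r <= 1 by rewrite -ler_pdivlMr // mul1r.
  by rewrite -[G.+1%:R]natr1 mulrDl mul1r; lra.
(* The remaining factor r^(t-h) absorbs the number of words; this is [gM] written with r =
   2^(-g(M)). *)
have Mr : (2 ^ M)%:R * r `^ (t - h%:R) <= 1.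
  rewrite /r word_radiusE // -powRrM natrX -powR_mulrn // -powRD ?pnatr_eq0 ?implybT //.
  by rewrite -[leRHS](powRr0 2) ler_powR ?ler1n //; move: gM; rewrite mulrC; lra.
have -> : r `^ t = r `^ (t - h%:R) * r ^+ h.
  rewrite -(powR_mulrn h (ltW r0)) -powRD ?subrK //.
  by rewrite (gt_eqF r0) implybT.
rewrite !natrM; set x1 := (2 ^ M)%:R in Mr *; set x2 := (_ ^ _)%:R; set x3 := (_ ^ n)%:R.
set x4 := (_ ^ h)%:R in Gr *; set y1 := r `^ _ in Mr *; set y2 := r ^+ h in Gr *.
have -> : x1 * x2 * x3 * x4 * (y1 * y2) = (x2 * x3) * ((x1 * y1) * (x4 * y2)) by ring.
rewrite ler_wpM2l ?mulr_ge0 ?ler0n // -[leRHS]mul1r ler_pM // mulr_ge0 ?ler0n ?powR_ge0 //.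
by rewrite exprn_ge0 // ltW.
Qed.
End box_counting.

Local Open Scope ereal_scope.

(** * Upper bounds for both dimensions *)

Section upper_bounds.
Context {R : realType} {n : nat} {g : 'I_n.+1 -> nat -> R}.
Context (g_ge0 : forall k m, (0 <= g k m)%R).
Context (g_homo : forall k, {homo g k : m m' / (m <= m')%N >-> (m <= m')%R}).
Context (g_unbounded : forall k x, exists m, (x < g k m)%R).

(** The cost bound of [stratum_cover] does not depend on the mesh [e]; the covers of the [n.+1] tags
    are put together. *)
Lemma stratum_measure (X : metricType R) (f : X -> tagspace g) l Q t :
  (forall x y, mdist (f x) (f y) = mdist x y) -> (forall x, stratum l Q (f x)) ->
  (0 <= t)%R ->
  (forall k : 'I_n.+1, (l <= k)%N ->
    exists M0, forall M, (M0 <= M)%N -> (M%:R <= (t - (k - l)%:R) * g k M)%R) ->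
  hausdorff_measure t [set: X] < +oo.
Proof.
move=> f_iso fQ t0 gt; set c := (2 ^ n * (size Q).+1 ^ n * 2 ^ n)%N.
apply: (@le_lt_trans _ _ ((c%:R *+ n.+1)%:E)); last exact: ltry.
apply: hausdorff_measure_le => e e0.
have /choice[L LP] k := stratum_cover g_ge0 g_homo g_unbounded f_iso fQ t0 e0 (gt k).
apply: (@hausdorff_content_seq _ _ _ _ _ (flatten [seq L k | k <- enum 'I_n.+1])).
- move=> x _; have [/(_ x erefl)[U UL Ux] _ _] := LP (ptag (f x)).
  exists U => //; apply/flattenP; exists (L (ptag (f x))) => //.
  by apply: map_f; rewrite mem_enum.
- move=> U /flattenP[_ /mapP[k _ ->]]; have [_ + _] := LP k; exact.
- rewrite big_flatten big_map /=.
  apply: (@le_trans _ _ (\sum_(k <- enum 'I_n.+1) c%:R%:E)).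
    by apply: lee_sum => k _; have [] := LP k.
  by rewrite sumEFin big_enum /= sumr_const card_ord.
Qed.

(** After [n.+1] boundaries nothing is left, since the tag is at most [n]. *)
Lemma dim_t_lt_stratum j l Q (X : metricType R) (f : X -> tagspace g) :
  (forall x y, mdist (f x) (f y) = mdist x y) -> (forall x, stratum l Q (f x)) ->
  (l + j = n.+1)%N -> dim_t_lt j X.
Proof.
elim: j l Q X f => [|j ih] l Q X f f_iso fQ ln /=.
  apply/seteqP; split=> // x _; have [_] := fQ x.
  by have := ltn_ord (ptag (f x)); lia.
have [B bB BQ] := stratum_basis g_ge0 g_homo g_unbounded f_iso fQ.
exists B => // U /BQ[Q' UQ'].
apply: (ih l.+1 Q' (boundary U : metricType R) (f \o set_val)); last by lia.
  by move=> x y; exact: f_iso.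
by move=> x; apply: UQ'; exact: set_valP.
Qed.

Context (d : 'I_n.+1 -> \bar R).
Context (d_ge : forall k, n%:R%:E <= d k).
Context (d_noninc : forall i j : 'I_n.+1, (i <= j)%N -> d j <= d i).
Context (g_dim : forall (k : 'I_n.+1) u, d k - k%:R%:E < u%:E ->
  exists M0, forall M, (M0 <= M)%N -> (M%:R <= u * g k M)%R).

(** When the recursion reaches [dim_H], [l] equals [k]. The piece of tag k' >= k then has dimension
    at most (d_k' - k') + (k' - k) = d_k' - k, which is at most d_k - k by monotonicity. *)
Lemma dim_tH_le j l Q (X : metricType R) (f : X -> tagspace g) (k : 'I_n.+1) :
  (forall x y, mdist (f x) (f y) = mdist x y) -> (forall x, stratum l Q (f x)) ->
  k = (l + j)%N :> nat -> dim_tH j X <= d k - l%:R%:E.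
Proof.
elim: j l Q X f => [|j ih] l Q X f f_iso fQ klj.
(* The bound has to cover empty spaces too, whose dimension is -1. *)
all: have dl : -1 <= d k - l%:R%:E.
1, 3: have := d_ge k; case: (d k) => [r| |] //; rewrite ?leey // lee_fin => nr.
1, 2: have ln : (l%:R <= n%:R :> R)%R by rewrite ler_nat; have := ltn_ord k; lia.
1, 2: by rewrite -EFinB lee_fin; lra.
  rewrite /=; case: ifP => // X0; rewrite /dim_H X0.
  move: (d_ge k) (d_noninc (i := k)) {dl}.
  case dk: (d k) => [r| |] // nr dnon; last by rewrite leey.
  (* [g_dim] only serves exponents strictly above the dimension, whence the slack [e]. *)
  apply/lee_addgt0Pr => e e0; apply: ereal_inf_lbound.
  exists (r - l%:R + e)%R; last by rewrite EFinD EFinB.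
  have lr : (l%:R <= r)%R.
    apply: (@le_trans _ _ n%:R); last by [].
    by rewrite ler_nat; have := ltn_ord k; lia.
  have t0 : (0 <= r - l%:R + e)%R by lra.
  split=> //; apply: stratum_measure f_iso fQ t0 _ => k' lk'.
  apply: g_dim; have := d_ge k'; have := dnon k'; rewrite klj addn0 => /(_ lk').
  case: (d k') => [r'| |] //; rewrite -EFinB !lee_fin lte_fin natrB // => r'r _.
  lra.
rewrite /=; case: ifP => // X0; apply: ereal_inf_lbound.
have [B bB BQ] := stratum_basis g_ge0 g_homo g_unbounded f_iso fQ.
exists B => // U /BQ[Q' UQ'].
rewrite (_ : d k - l%:R%:E - 1 = d k - l.+1%:R%:E).
  apply: (ih l.+1 Q' (boundary U : metricType R) (f \o set_val)); last by lia.
    by move=> x y; exact: f_iso.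
  by move=> x; apply: UQ'; exact: set_valP.
by case: (d k) => [r| |] //; rewrite -!EFinB -natr1 opprD addrA.
Qed.
End upper_bounds.

(** * The extremal compactum *)

Local Open Scope ring_scope.

Section extremal_compactum.
Context {R : realType} {n : nat} {g : 'I_n.+1 -> nat -> R}.
Context (g_ge0 : forall k m, (0 <= g k m)%R).
Context (g_homo : forall k, {homo g k : m m' / (m <= m')%N >-> (m <= m')%R}).
Context (g_unbounded : forall k x, exists m, (x < g k m)%R).

(* The words of tag [k] times [[0, 1]^k]. *)
Definition extremal : set (tagspace g) := [set p | forall i : 'I_n,
  if (i < ptag p)%N then 0 <= pcoord p i <= 1 else pcoord p i == 0].

Lemma extremal_compact : compact extremal.
Proof.
pose A (k : 'I_n.+1) (i : 'I_n) : set R := if (i < k)%N then `[0, 1]%classic else [set 0].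
have cA k i : compact (A k i).
  by rewrite /A; case: ifP => _; [exact: segment_compact|exact: compact_set1].
have cK k := compact_block g_ge0 g_homo g_unbounded (k := k) (cA k).
apply/compact_near_coveringP => I F P FF PF.
have HK : \forall i \near F, forall k : 'I_n.+1,
    [set p : tagspace g | ptag p = k /\ forall i, A k i (pcoord p i)] `<=` P i.
  apply: filter_forall => k; have /compact_near_coveringP H := cK k.
  apply: H => p [tp Ap]; apply: PF => i; have := Ap i; rewrite /A tp.
  by case: ifP => _ /=; [rewrite in_itv|move=> ->].
apply: filterS HK => i H p Kp; apply: (H (ptag p)); split=> // j.
by have := Kp j; rewrite /A; case: ifP => _ /=; [rewrite in_itv|move/eqP].
Qed.

(** Coordinates from the tag on are 0, so the free ones are among the first [ptag p]. *)
Lemma extremal_stratum (p : tagspace g) : extremal p -> stratum 0 [:: 0] p.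
Proof.
move=> Kp; split=> [i|].
  by have := Kp i; case: ifP => // _ /eqP->; rewrite lexx ler01.
rewrite addn0 -[leqRHS](card_ord (ptag p)).
have pn : (ptag p <= n)%N by rewrite -ltnS.
have w_inj : injective (widen_ord pn) by move=> i j [/ord_inj].
rewrite -(fintype.card_image w_inj); apply: subset_leq_card.
apply/fintype.subsetP => i; rewrite !inE => ci; have := Kp i.
case: ifP => [ip _|_ /eqP ci0]; last by rewrite ci0 eqxx in ci.
by apply/fintype.imageP; exists (Ordinal ip) => //; exact: ord_inj.
Qed.

Definition clamp (x : R) : R := Num.min (Num.max x 0) 1.

Lemma clamp01 x : 0 <= clamp x <= 1.
Proof. by rewrite /clamp le_min ge_min le_max !lexx ler01 !orbT. Qed.

Lemma clamp_id x : 0 <= x <= 1 -> clamp x = x.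
Proof. by move=> /andP[x0 x1]; rewrite /clamp max_l // min_l. Qed.

Lemma clamp_dist x y : `|clamp x - clamp y| <= `|x - y|.
Proof.
have H z : [\/ z <= 0 /\ clamp z = 0, 0 <= z <= 1 /\ clamp z = z | 1 <= z /\ clamp z = 1].
  rewrite /clamp; have [z0|z0] := leP z 0; first by apply: Or31; rewrite min_l.
  have [z1|z1] := leP z 1; first by apply: Or32; rewrite (ltW z0).
  by apply: Or33; rewrite (ltW z1).
have xy := ler_norm (x - y); have yx := ler_norm (y - x); rewrite distrC in yx.
rewrite ler_norml.
by case: (H x) => -[? ->]; case: (H y) => -[? ->]; lra.
Qed.

(** Clamping puts the point in [extremal] for every real [u], so that the cube is parametrized by a
    total map into the subtype. *)
Definition cube_pt (k : 'I_n.+1) (z : nat -> bool) (u : 'I_k -> R) : tagspace g :=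
  (k, z, fun i : 'I_n => if insub (i : nat) is Some j then clamp (u j) else 0).

Lemma cube_pt_extremal k z u : extremal (@cube_pt k z u).
Proof.
move=> i; rewrite /pcoord /ptag /=; case: ifP => ik.
  by rewrite insubT clamp01.
by rewrite insubF.
Qed.

Definition cube_in k z u : extremal :=
  exist _ (@cube_pt k z u) (mem_set (@cube_pt_extremal k z u)).

Lemma cube_fibre_not_covdim_lt (k : 'I_n.+1) z (F : set extremal) : compact F ->
  (forall u, F (@cube_in k z u)) -> ~ covdim_lt k F.
Proof.
move=> cF Fu; have kn : (k <= n)%N by rewrite -ltnS.
pose x (j : 'I_k) (p : extremal) : R := pcoord (set_val p) (widen_ord kn j).
apply: (@cube_not_covdim_lt _ _ _ _ (@cube_in k z) x) => // [j p|u u01|u v e e0 uve].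
- apply: (@continuous_comp _ _ _ set_val (fun q => pcoord q (widen_ord kn j))).
    exact: initial_continuous.
  exact: pcoord_continuous.
- split=> // j; rewrite /x /cube_in set_valE /pcoord /= insubT //= => jk.
  by rewrite clamp_id //; congr u; apply: ord_inj.
- have -> : mdist (cube_in z u) (cube_in z v) = mdist (cube_pt z u) (cube_pt z v) by [].
  have [k0|k0] := posnP k.
    rewrite (_ : cube_pt z u = cube_pt z v) ?mdistxx //.
    apply: space_eqP => // i; rewrite /pcoord /= insubF //; lia.
  pose m := \big[Num.max/0]_j `|u j - v j|.
  apply: (@le_lt_trans _ _ m).
    apply/mdist_spaceP; split=> // [|i]; first exact: bigmax_ge_id.
    rewrite /pcoord /=; case: insubP => [j _ _|_]; last first.
      by rewrite subrr normr0; exact: bigmax_ge_id.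
    by apply: le_trans (clamp_dist _ _) _; exact: (le_bigmax _ (fun j => `|u j - v j|)).
  by apply/bigmax_ltP; split.
Qed.

End extremal_compactum.

Local Open Scope ereal_scope.

(** * Lower bounds for the extremal compactum *)

Section extremal_dimension.
Context {R : realType} {n : nat} {g : 'I_n.+1 -> nat -> R}.
Context (g_ge0 : forall k m, (0 <= g k m)%R).
Context (g_homo : forall k, {homo g k : m m' / (m <= m')%N >-> (m <= m')%R}).
Context (g_unbounded : forall k x, exists m, (x < g k m)%R).

Local Notation K := (@extremal R n g : metricType R).

Lemma compact_extremal : compact [set: K].
Proof. exact/compact_subtype/extremal_compact. Qed.

Definition word_part (p : tagspace g) : tagspace g := (ptag p, pword p, fun=> 0%R).

Lemma word_part_dist p q : (mdist (word_part p) (word_part q) <= mdist p q)%R.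
Proof.
have /mdist_spaceP[r0 t w _] := lexx (mdist p q).
by apply/mdist_spaceP; split=> // i; rewrite subrr normr0.
Qed.

(** [dim_tH_ge] is applied to the projection that forgets the coordinates: the words of tag [k] are
    non-null in dimension [t], and the fibre over each contains a [k]-cube. *)
Lemma extremal_dim_ge (k : 'I_n.+1) t b : (0 <= t)%R ->
  (forall M, t * g k M <= M%:R + b)%R -> (t + k%:R)%:E <= dim_tH k K.
Proof.
move=> t0 gb; apply: (@dim_tH_ge _ _ t k K (word_part \o set_val) (word_set k)) => //.
- exact: compact_extremal.
- by move=> x y; exact: word_part_dist.
- exact: word_set_measure_neq0 gb.
move=> c [tc cc]; apply: (cube_fibre_not_covdim_lt (z := pword c)) => [|u].
  apply: (@subclosed_compact _ _ [set: K]) => //; last exact: compact_extremal.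
  apply: closed_comp => [x _|]; last first.
    exact/accessible_closed_set1/hausdorff_accessible/metric_hausdorff.
  move=> U /nbhs_ballP[e /= e0 eU]; apply/nbhs_ballP; exists e => // y.
  rewrite !ballEmdist => xy; apply: eU; rewrite ballEmdist.
  by apply: le_lt_trans xy; exact: word_part_dist.
by apply: space_eqP => // i; rewrite cc.
Qed.

End extremal_dimension.

Theorem theorem5p4 (R : realType) (n : nat) (d : 'I_n.+1 -> \bar R)
  (d_ge : forall k, n%:R%:E <= d k)
  (d_noninc : forall i j : 'I_n.+1, (i <= j)%N -> d j <= d i) :
  exists K : metricType R,
    [/\ compact [set: K],
        dim_t R K = n%:R%:E &
        forall k : 'I_n.+1, dim_tH k K = d k].
Proof.
have s_ge0 (k : 'I_n.+1) : 0 <= d k - k%:R%:E.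
  apply: (@le_trans _ _ (n%:R%:E - k%:R%:E)); last exact: leeB.
  by rewrite -EFinB lee_fin subr_ge0 ler_nat -ltnS.
(* The words of tag [k] get dimension d_k - k; the cube supplies the other [k]. *)
have /choice[g gP] (k : 'I_n.+1) := dimension_exponent (s_ge0 k).
have g_ge0 k m : (0 <= g k m)%R by have [+ _ _ _ _] := gP k; exact.
have g_homo k : {homo g k : m m' / (m <= m')%N >-> (m <= m')%R} by have [] := gP k.
have g_unbounded k x : exists m, (x < g k m)%R by have [_ _ + _ _] := gP k; exact.
pose K := (@extremal R n g : metricType R).
have K_stratum (x : K) : stratum 0 [:: 0%R] (set_val x).
  exact/extremal_stratum/set_valP.
have cK : compact [set: K] by exact: compact_extremal.
exists K; split=> // [|k].
  apply/eqP; rewrite eq_le; apply/andP; split.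
    have := @dim_t_lt_stratum _ _ _ g_ge0 g_homo g_unbounded n.+1 0 _ K set_val.
    move=> /(_ _ (fun _ _ => erefl) K_stratum (add0n _))/(@dim_t_le R).
    by rewrite -natr1 addrK.
  (* A smaller dimension would contradict the [n]-cube over a word of the largest tag. *)
  rewrite leNgt; apply/negP => /dim_t_ltP/(dim_t_lt_covdim_lt cK).
  exact: (@cube_fibre_not_covdim_lt _ _ _ ord_max (fun=> false)).
apply/eqP; rewrite eq_le; apply/andP; split.
  have g_dim k' u : d k' - k'%:R%:E < u%:E ->
      exists M0, forall M, (M0 <= M)%N -> (M%:R <= u * g k' M)%R.
    by have [_ _ _ + _] := gP k'; exact.
  rewrite -[leRHS]sube0.
  exact: (@dim_tH_le _ _ _ g_ge0 g_homo g_unbounded d d_ge d_noninc g_dim k 0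
    [:: 0%R] K set_val k (fun _ _ => erefl) K_stratum).
have lower t : (0 <= t)%R -> t%:E <= d k - k%:R%:E -> (t + k%:R)%:E <= dim_tH k K.
  move=> t0 td; have [_ _ _ _ /(_ t t0 td)[b gb]] := gP k.
  exact: extremal_dim_ge gb.
move: (d_ge k) (s_ge0 k) lower; case: (d k) => [r| |] // _.
  by rewrite -EFinB lee_fin => r0 /(_ _ r0 (lexx _)); rewrite subrK.
(* For an infinite [d k] every t >= 0 is admissible, so the dimension exceeds every real. *)
move=> _ lower; suff -> : dim_tH k K = +oo by [].
apply/eqyP => A A0; apply: le_trans (lower A (ltW A0) (leey _)).
by rewrite lee_fin lerDl.
Qed.
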